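(* Under the sphere assumption, a sequence $y\in\mathcal H$ has a representing measure on $K$ if and only if $M_d(g_iy)\succeq0$ for all $i=0,\dots,m$ and all $d\in\mathbb N$.
   Context: Complex setting: $n,m\in\mathbb N^*$, $z^\alpha=z_1^{\alpha_1}\cdots z_n^{\alpha_n}$, $|\alpha|=\sum\alpha_i$. $g_1,\dots,g_m$ are real-valued complex polynomials $g_i(z)=\sum_{|\gamma|,|\delta|\le k_i}g_{i,\gamma,\delta}\bar z^\gamma z^\delta$ with $\overline{g_{i,\gamma,\delta}}=g_{i,\delta,\gamma}$; $g_0:=1$; $K=\{z\in\mathbb C^n:g_i(z)\ge0,\ i=1,\dots,m\}$. $\mathcal H$ is the set of complex families $y=(y_{\alpha,\beta})_{\alpha,\beta\in\mathbb N^n}$ with $\overline{y_{\alpha,\beta}}=y_{\beta,\alpha}$. $M_d(g_iy)$ is the Hermitian matrix indexed by $|\alpha|,|\beta|\le d$ with entries $\sum_{|\gamma|,|\delta|\le k_i}g_{i,\gamma,\delta}y_{\alpha+\gamma,\beta+\delta}$. $y$ has a representing measure $\mu$ on $K$ if $\mu$ is a positive Radon measure on $K$ and $y_{\alpha,\beta}=\int_K\bar z^\alpha z^\beta\,d\mu$ for all $\alpha,\beta$. Sphere assumption: for some $R>0$ the constraints include $R^2-\sum_{j}|z_j|^2\ge0$ and $-(R^2-\sum_j|z_j|^2)\ge0$. *)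

(* Defs.v *)
From HB Require Import structures.
From mathcomp Require Import all_boot all_order all_algebra.
From mathcomp Require Import all_classical all_reals all_analysis.
From mathcomp Require Import complex.
Set Implicit Arguments. Unset Strict Implicit. Unset Printing Implicit Defensive.
Import Order.TTheory GRing.Theory Num.Theory.
Local Open Scope ring_scope.
Local Open Scope classical_set_scope.

Definition mi (n : nat) := {ffun 'I_n -> nat}.
Definition mdeg n (a : mi n) : nat := (\sum_(j < n) a j)%N.
Definition maddi n (a b : mi n) : mi n := [ffun j => (a j + b j)%N].
Definition mzero n : mi n := [ffun => 0%N].

(* Finite enumeration of the multi-indices with |alpha| <= d:
   elements of {ffun 'I_n -> 'I_d.+1} satisfying bnd, converted by tomi (injective). *)
Definition bidx (n d : nat) := {ffun 'I_n -> 'I_d.+1}.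
Definition bnd n d : pred (bidx n d) := fun a => (\sum_(j < n) (a j : nat) <= d)%N.
Definition tomi n d (a : bidx n d) : mi n := [ffun j => (a j : nat)].

(* The complex space C^n, realised as n-tuples of pairs (Re, Im) with the
   product (= Borel) sigma-algebra of mathcomp-analysis. *)
Definition Cn (R : realType) (n : nat) := (n.-tuple (R * R))%type.
Definition coord (R : realType) n (z : Cn R n) (j : 'I_n) : R[i] :=
  Complex (tnth z j).1 (tnth z j).2.

Definition zmon (R : realType) n (z : Cn R n) (b : mi n) : R[i] :=
  \prod_(j < n) coord z j ^+ b j.
Definition zbarmon (R : realType) n (z : Cn R n) (a : mi n) : R[i] :=
  \prod_(j < n) (coord z j)^* ^+ a j.

Definition peval (R : realType) n (k : nat) (c : mi n -> mi n -> R[i]) (z : Cn R n) : R[i] :=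
  \sum_(g : bidx n k | bnd g) \sum_(h : bidx n k | bnd h)
     c (tomi g) (tomi h) * zbarmon z (tomi g) * zmon z (tomi h).

Definition Kset (R : realType) n m (k : 'I_m -> nat) (gc : 'I_m -> mi n -> mi n -> R[i]) :
  set (Cn R n) := [set z | forall i : 'I_m, 0 <= peval (k i) (gc i) z].

(* coefficients of R^2 - sum_j |z_j|^2 *)
Definition sphere_coef (R : realType) n (rad : R) (a b : mi n) : R[i] :=
  if (a == mzero n) && (b == mzero n) then Complex (rad ^+ 2) 0
  else if (a == b) && (mdeg a == 1)%N then -1 else 0.

Definition one_coef (R : realType) n (a b : mi n) : R[i] :=
  if (a == mzero n) && (b == mzero n) then 1 else 0.

(* the family g_0 = 1, g_1, ..., g_m indexed by 'I_m.+1 *)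
Definition ext0 (T : Type) m (f : 'I_m -> T) (t0 : T) (i : 'I_m.+1) : T :=
  match unlift ord0 i with Some j => f j | None => t0 end.

Definition hermitian_seq (R : realType) n (y : mi n -> mi n -> R[i]) : Prop :=
  forall a b, (y a b)^* = y b a.

(* entries of M_d(g y) (independent of d except for the index range) *)
Definition mom_entry (R : realType) n (k : nat) (c : mi n -> mi n -> R[i])
  (y : mi n -> mi n -> R[i]) (a b : mi n) : R[i] :=
  \sum_(g : bidx n k | bnd g) \sum_(h : bidx n k | bnd h)
     c (tomi g) (tomi h) * y (maddi a (tomi g)) (maddi b (tomi h)).

(* M_d(...) is positive semidefinite: v^* M v >= 0 for every complex vector v
   indexed by the multi-indices of degree <= d (0 <= x in R[i] means x real >= 0). *)
Definition mom_psd (R : realType) n (d : nat) (M : mi n -> mi n -> R[i]) : Prop :=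
  forall v : bidx n d -> R[i],
    0 <= \sum_(a : bidx n d | bnd a) \sum_(b : bidx n d | bnd b)
            (v a)^* * M (tomi a) (tomi b) * v b.

(* y has a representing (positive, finite Borel = Radon) measure mu on K:
   mu is concentrated on K and y_{a,b} = int zbar^a z^b dmu
   (real and imaginary parts integrated separately). *)
Definition has_rep_measure (R : realType) n (K : set (Cn R n))
  (y : mi n -> mi n -> R[i]) : Prop :=
  exists mu : {measure set (Cn R n) -> \bar R},
    mu (~` K) = 0%E /\ (mu setT < +oo)%E /\
    forall a b : mi n,
      mu.-integrable setT (fun z => (complex.Re (zbarmon z a * zmon z b))%:E) /\
      mu.-integrable setT (fun z => (complex.Im (zbarmon z a * zmon z b))%:E) /\
      y a b = Complex (Rintegral mu setT (fun z => complex.Re (zbarmon z a * zmon z b)))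
                      (Rintegral mu setT (fun z => complex.Im (zbarmon z a * zmon z b))).

(* Main.v *)
Require Import Defs.
From HB Require Import structures.
From mathcomp Require Import all_boot all_order all_algebra.
From mathcomp Require Import all_classical all_reals all_analysis.
From mathcomp Require Import measurable_realfun.
From mathcomp Require Import complex zify ring lra.
From mathcomp Require Import -(notations) mpoly.
From mathcomp Require Import ssrcomplements.
Import Order.TTheory GRing.Theory Num.Theory.
Import numFieldNormedType.Exports.
Import Defs.
Set Implicit Arguments. Unset Strict Implicit. Unset Printing Implicit Defensive.
Local Open Scope ring_scope.

(* Write L for the linear functional on the polynomials in z, zbar given by
   L(zbar^a z^b) = y_{a,b}.  Modulo the sphere equation,
     r (2 r + u z_j + conj(u) zbar_j) = |r + u z_j|^2 + \sum_(i != j) |z_i|^2   if |u| = 1,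
   so, up to positive factors, r +- Re z_j and r +- Im z_j are sums of squares |p|^2 of
   holomorphic p, and such sums are closed under products.  Hence M_d(y) >= 0 makes L
   nonnegative on the Bernstein polynomials of the cube [-r, r]^(2n), and L is represented
   by a measure on that cube (Hausdorff's moment problem).  That measure is the law of a map
   defined on an interval with Lebesgue measure: the weak limit of the discrete Bernstein
   measures is described by its masses on binary boxes, which are realised as lengths of
   nested intervals.
   For the support, c - g_i is also such a sum of squares for c large, so M_d(g_i y) >= 0
   gives 0 <= \int g_i (c - g_i)^N dmu for all N, which forces g_i >= 0 almost everywhere. *)

(** * Sums of Hermitian squares modulo the sphere *)

(** Vectors in [mom_psd] are indexed by holomorphic monomials only, so the hypothesis gives L(|p|^2)
    >= 0 for p in z alone; squares of real polynomials in z and zbar are not at hand. The sphere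
    closes this gap: expanding |r + u z_j|^2 produces |z_j|^2, and adding the other |z_i|^2
    completes it to the constant r^2, which leaves an affine function of Re(u z_j). The second
    obstacle is the weak limit. Masses of half-open boxes converge along an ultrafilter, but their
    limits need not be the masses of these boxes under the limit measure, since mass may drift onto
    a face. The limits are still additive under subdivision, which is all that nested intervals
    need. A point of the interval is sent to the point common to the closed boxes on its path, so
    countable additivity is inherited from Lebesgue measure. *)

Section SphereCone.
Variables (C : numClosedFieldType) (n : nat).
Local Notation B := (mpoly (n + n) C).
Local Notation cst := (mpolyC (n + n) (R := C)).

Definition holX (j : 'I_n) : B := mpolyX C (mnm1 (lshift n j)).
Definition antX (j : 'I_n) : B := mpolyX C (mnm1 (rshift n j)).

Definition holP (P : mpoly n C) : B := mmap cst holX P.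
(** z and zbar are independent indeterminates here. Conjugating the coefficients makes [antP P] the
    formal conjugate of [holP P], so that [antP P * holP P] is |P|^2. *)
Definition antP (P : mpoly n C) : B := mmap (cst \o Num.conj) antX P.

Let holP_additive : additive holP. Proof. exact: mmap_is_additive. Qed.
Let holP_multiplicative : multiplicative holP.
Proof. exact: mmap_is_multiplicative. Qed.
Let antP_additive : additive antP. Proof. exact: mmap_is_additive. Qed.
Let antP_multiplicative : multiplicative antP.
Proof. exact: mmap_is_multiplicative. Qed.

HB.instance Definition _ := GRing.isAdditive.Build (mpoly n C) B holP holP_additive.
HB.instance Definition _ :=
  GRing.isMultiplicative.Build (mpoly n C) B holP holP_multiplicative.
HB.instance Definition _ := GRing.isAdditive.Build (mpoly n C) B antP antP_additive.
HB.instance Definition _ :=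
  GRing.isMultiplicative.Build (mpoly n C) B antP antP_multiplicative.

Lemma holPX j : holP (mpolyX C (mnm1 j)) = holX j.
Proof. by rewrite /holP mmapX mmap1U. Qed.

Lemma antPX j : antP (mpolyX C (mnm1 j)) = antX j.
Proof. by rewrite /antP mmapX mmap1U. Qed.

Lemma holPC c : holP (mpolyC n c) = cst c.
Proof. by rewrite /holP mmapC. Qed.

Lemma antPC c : antP (mpolyC n c) = cst c^*.
Proof. by rewrite /antP mmapC. Qed.

Lemma holPM P Q : holP (P * Q) = holP P * holP Q.
Proof. exact: rmorphM. Qed.

Lemma antPM P Q : antP (P * Q) = antP P * antP Q.
Proof. exact: rmorphM. Qed.

Lemma holPD P Q : holP (P + Q) = holP P + holP Q.
Proof. exact: raddfD. Qed.

Lemma antPD P Q : antP (P + Q) = antP P + antP Q.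
Proof. exact: raddfD. Qed.

Lemma holPXm m : holP (mpolyX C m) = \prod_j holX j ^+ m j.
Proof. by rewrite /holP mmapX. Qed.

Lemma antPXm m : antP (mpolyX C m) = \prod_j antX j ^+ m j.
Proof. by rewrite /antP mmapX. Qed.

Lemma holPZ c P : holP (c *: P) = c *: holP P.
Proof. by rewrite -mul_mpolyC holPM holPC mul_mpolyC. Qed.

Lemma antPZ c P : antP (c *: P) = c^* *: antP P.
Proof. by rewrite -mul_mpolyC antPM antPC mul_mpolyC. Qed.

Lemma holP0 : holP 0 = 0. Proof. exact: raddf0. Qed.
Lemma antP0 : antP 0 = 0. Proof. exact: raddf0. Qed.

Lemma holP_sum (I : finType) (P : pred I) (F : I -> mpoly n C) :
  holP (\sum_(i | P i) F i) = \sum_(i | P i) holP (F i).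
Proof. exact: raddf_sum. Qed.

Lemma antP_sum (I : finType) (P : pred I) (F : I -> mpoly n C) :
  antP (\sum_(i | P i) F i) = \sum_(i | P i) antP (F i).
Proof. exact: raddf_sum. Qed.

#[local] Opaque holP antP.

Definition sphP (r : C) : B := cst (r ^+ 2) - \sum_(j < n) antX j * holX j.

Inductive sos (r : C) : B -> Prop :=
| sos_sq P : sos r (antP P * holP P)
| sos_sph f : sos r (f * sphP r)
| sosD p q : sos r p -> sos r q -> sos r (p + q).

Variable r : C.

Lemma sosM p q : sos r p -> sos r q -> sos r (p * q).
Proof.
elim=> [P|f|p1 p2 _ IH1 _ IH2].
- elim=> [Q|f|q1 q2 _ IH1 _ IH2].
  + have -> : antP P * holP P * (antP Q * holP Q) = antP (P * Q) * holP (P * Q).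
      by rewrite antPM holPM; move: (antP P) (holP P) (antP Q) (holP Q) => *; rewrite mulrACA.
    exact: sos_sq.
  + rewrite mulrA; exact: sos_sph.
  + rewrite mulrDr; exact: sosD.
- by move=> _; rewrite mulrAC; exact: sos_sph.
- by move=> sq; rewrite mulrDl; apply: sosD; [exact: IH1|exact: IH2].
Qed.

Lemma sos_ge0 (L : B -> C) :
  (forall p q, L (p + q) = L p + L q) ->
  (forall P, 0 <= L (antP P * holP P)) -> (forall f, L (f * sphP r) = 0) ->
  forall q, sos r q -> 0 <= L q.
Proof.
move=> LD Lsq Lsph q; elim=> [P|f|p1 p2 _ h1 _ h2]; first exact: Lsq.
  by rewrite Lsph.
by rewrite LD addr_ge0.
Qed.

Lemma sos_mod p q f : sos r q -> p = q + f * sphP r -> sos r p.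
Proof. by move=> sq ->; apply: sosD => //; exact: sos_sph. Qed.

Lemma sosC c : 0 <= c -> sos r (cst c).
Proof.
move=> c0; have -> : cst c = antP (mpolyC n (sqrtC c)) * holP (mpolyC n (sqrtC c)).
  rewrite antPC holPC -rmorphM; congr (cst _).
  by rewrite conj_Creal ?ger0_real ?sqrtC_ge0// -expr2 sqrtCK.
exact: sos_sq.
Qed.

Lemma sos1 : sos r 1. Proof. by rewrite -(rmorph1 cst); exact: sosC. Qed.
Lemma sos0 : sos r 0. Proof. by rewrite -(rmorph0 cst); exact: sosC. Qed.

Lemma sosZ c q : 0 <= c -> sos r q -> sos r (c *: q).
Proof. by move=> c0 sq; rewrite -mul_mpolyC; apply: sosM => //; exact: sosC. Qed.

Lemma sosX q k : sos r q -> sos r (q ^+ k).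
Proof.
by move=> sq; elim: k => [|k IH]; [exact: sos1|rewrite exprS; exact: sosM].
Qed.

Lemma sos_sum (I : Type) (s : seq I) (P : pred I) (F : I -> B) :
  (forall i, P i -> sos r (F i)) -> sos r (\sum_(i <- s | P i) F i).
Proof. by move=> h; elim/big_ind: _ => //; [exact: sos0|exact: sosD]. Qed.

Lemma sos_prod (I : Type) (s : seq I) (P : pred I) (F : I -> B) :
  (forall i, P i -> sos r (F i)) -> sos r (\prod_(i <- s | P i) F i).
Proof. by move=> h; elim/big_ind: _ => //; [exact: sos1|exact: sosM]. Qed.

Lemma sos_coord j : sos r (antX j * holX j).
Proof. by rewrite -holPX -antPX; exact: sos_sq. Qed.

(* Modulo the sphere, r times this element is |r + u z_j|^2 + \sum_(i != j) |z_i|^2. *)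
Lemma sos_affine u j : 0 < r -> u * u^* = 1 ->
  sos r (cst (r *+ 2) + cst u * holX j + cst u^* * antX j).
Proof.
move=> r0 uu; have rr : r^* = r by rewrite conj_Creal// gtr0_real.
set w := _ + _.
have ->: w = r^-1 *: (r *: w) by rewrite scalerA mulVf ?scale1r// gt_eqF.
apply: sosZ; first by rewrite invr_ge0 ltW.
pose P : mpoly n C := mpolyC n r + mpolyC n u * mpolyX C (mnm1 j).
have sq : sos r (antP P * holP P + \sum_(i < n | i != j) antX i * holX i).
  apply: sosD; first exact: sos_sq.
  by apply: sos_sum => i _; exact: sos_coord.
apply: (sos_mod (f := 1) sq).
rewrite mul1r /sphP [X in _ - X](bigD1 j)//= /P !rmorphD !rmorphM /= !antPC !holPC !holPX !antPX.
rewrite rr -mul_mpolyC /w mulr2n !rmorphD /=.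
have : cst u * cst u^* = 1 by rewrite -rmorphM uu rmorph1.
move: (cst u) (cst u^*) (cst r) (holX j) (antX j) (\sum_(i < n | i != j) _).
move=> a b c x y s ab.
have -> : (c + b * y) * (c + a * x) = c * c + c * (a * x) + b * y * c + (a * b) * (y * x).
  by ring.
by rewrite ab; ring.
Qed.

(** The Archimedean property of the cone, one-sided: an upper bound by a constant. *)
Definition sos_bounded q := exists2 c : C, 0 <= c & sos r (cst c - q).

Lemma sos_boundedD p q : sos_bounded p -> sos_bounded q -> sos_bounded (p + q).
Proof.
move=> [c c0 sc] [d d0 sd]; exists (c + d); first exact: addr_ge0.
by rewrite rmorphD /= opprD addrACA; exact: sosD.
Qed.

Lemma sos_boundedZ c p : 0 <= c -> sos_bounded p -> sos_bounded (c *: p).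
Proof.
move=> c0 [d d0 sd]; exists (c * d); first exact: mulr_ge0.
by rewrite rmorphM /= mul_mpolyC -scalerBr; exact: sosZ.
Qed.

Lemma sos_bounded_sum (I : Type) (s : seq I) (P : pred I) (F : I -> B) :
  (forall i, P i -> sos_bounded (F i)) -> sos_bounded (\sum_(i <- s | P i) F i).
Proof.
move=> h; elim/big_ind: _ => //; last exact: sos_boundedD.
by exists 0 => //; rewrite rmorph0 subr0; exact: sos0.
Qed.

(** cd - pq = d (c - p) + p (d - q); this is why p must itself lie in the cone. *)
Lemma sos_boundedM p q : sos r p ->
  sos_bounded p -> sos_bounded q -> sos_bounded (p * q).
Proof.
move=> sp [c c0 sc] [d d0 sd]; exists (c * d); first exact: mulr_ge0.
have -> : cst (c * d) - p * q = cst d * (cst c - p) + p * (cst d - q).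
  by rewrite rmorphM /=; move: (cst c) (cst d) => x y; ring.
by apply: sosD; apply: sosM => //; exact: sosC.
Qed.

Lemma sos_boundedX q k : sos r q -> sos_bounded q -> sos_bounded (q ^+ k).
Proof.
move=> sq bq; elim: k => [|k IH]; last by rewrite exprS; exact: sos_boundedM.
by exists 1 => //; rewrite expr0 rmorph1 subrr; exact: sos0.
Qed.

Lemma sos_bounded_prod (I : Type) (s : seq I) (F : I -> B) :
  (forall i, sos r (F i)) -> (forall i, sos_bounded (F i)) ->
  sos_bounded (\prod_(i <- s) F i).
Proof.
move=> h1 h2.
elim: s => [|i s IH].
  by rewrite big_nil; exists 1 => //; rewrite rmorph1 subrr; exact: sos0.
by rewrite big_cons; exact: sos_boundedM.
Qed.

Lemma sos_bounded_coord j : 0 < r -> sos_bounded (antX j * holX j).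
Proof.
move=> r0; exists (r ^+ 2); first by rewrite exprn_ge0// ltW.
have s : sos r (\sum_(i < n | i != j) antX i * holX i).
  by apply: sos_sum => i _; exact: sos_coord.
apply: (sos_mod (f := 1) s).
by rewrite mul1r /sphP [X in _ + (_ - X)](bigD1 j)//=; ring.
Qed.

Lemma sos_bounded_sq (m : multinom n) : 0 < r ->
  sos_bounded (antP (mpolyX C m) * holP (mpolyX C m)).
Proof.
move=> r0; rewrite antPXm holPXm -big_split /=.
apply: sos_bounded_prod => i.
  by rewrite -exprMn; exact/sosX/sos_coord.
rewrite -exprMn; apply: sos_boundedX; first exact: sos_coord.
exact: sos_bounded_coord.
Qed.

(** Expanding |p - c q|^2 bounds the cross terms by |p|^2 + |c|^2 |q|^2, and squared monomials are
    already bounded. *)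
Lemma sos_bounded_herm c (m m' : multinom n) : 0 < r ->
  sos_bounded (c *: (antP (mpolyX C m) * holP (mpolyX C m'))
             + c^* *: (antP (mpolyX C m') * holP (mpolyX C m))).
Proof.
move=> r0; move: (sos_bounded_sq m r0) (sos_bounded_sq m' r0).
move: (mpolyX C m) (mpolyX C m') => p q bp bq.
have [d d0 sd] := sos_boundedD bp (sos_boundedZ (mul_conjC_ge0 c) bq).
exists d; [exact: d0|]; have := sosD sd (sos_sq r (p - mpolyC n c * q)).
congr sos; rewrite !rmorphB /= antPM holPM antPC holPC -!mul_mpolyC rmorphM /=.
by move: (cst c) (cst c^*) (cst d) (antP p) (antP q) (holP p) (holP q) => *; ring.
Qed.

End SphereCone.
Opaque holP antP.

(** * Bernstein polynomials *)

Section Bernstein.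
Variable A : comNzRingType.

(** These are the factorial moments of the binomial law. They hold as a polynomial identity, so [t]
    may be an element of any commutative ring, where convergence of Bernstein polynomials would have
    no meaning. The key is C(k, a) C(N, k) = C(N, a) C(N - a, k - a), followed by the binomial
    theorem. *)
Lemma bernstein_factorial_moment (t : A) a N : (a <= N)%N ->
  \sum_(k < N.+1) 'C(k, a)%:R * ('C(N, k)%:R * t ^+ k * (1 - t) ^+ (N - k)) =
  'C(N, a)%:R * t ^+ a.
Proof.
move=> aN; rewrite -(big_mkord xpredT
  (fun k => 'C(k, a)%:R * ('C(N, k)%:R * t ^+ k * (1 - t) ^+ (N - k)))).
rewrite (@big_cat_nat _ _ _ a)//=; last exact: leqW.
rewrite big_nat_cond big1 ?add0r; last first.
  by move=> k /andP[/andP[_ ka] _]; rewrite bin_small// mul0r.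
rewrite -{1}(add0n a) big_addn subSn// big_mkord.
have E (j : 'I_(N - a).+1) : 'C(j + a, a)%:R *
    ('C(N, j + a)%:R * t ^+ (j + a) * (1 - t) ^+ (N - (j + a))) =
    'C(N, a)%:R * t ^+ a * ((1 - t) ^+ (N - a - j) * t ^+ j *+ 'C(N - a, j)).
  have jle : (j <= N - a)%N by rewrite -ltnS.
  have jaN : (j + a <= N)%N by lia.
  have bE : ('C(j + a, a) * 'C(N, j + a) = 'C(N, a) * 'C(N - a, j))%N.
    apply/eqP; rewrite -(eqn_pmul2r (_ : 0 < a`! * j`! * (N - a - j)`!)%N); last first.
      by rewrite !muln_gt0 !fact_gt0.
    have e1 := bin_fact jaN; have e2 := bin_fact aN; have e3 := bin_fact jle.
    have e4 := bin_fact (leq_addl j a); rewrite addnK in e4.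
    have -> : (N - a - j = N - (j + a))%N by rewrite -subnDA addnC.
    have e3' : ('C(N - a, j) * (j`! * (N - (j + a))`!) = (N - a)`!)%N.
      by rewrite -e3 -subnDA (addnC a).
    apply/eqP; transitivity N`!.
      by rewrite -e1 -e4; ring.
    by rewrite -e2 -e3'; ring.
  rewrite -subnDA (addnC a) exprD -mulr_natr.
  transitivity (('C(j + a, a) * 'C(N, j + a))%N%:R *
    (t ^+ j * t ^+ a * (1 - t) ^+ (N - (j + a)))).
    by rewrite natrM; ring.
  by rewrite bE natrM; ring.
rewrite (eq_bigr _ (fun j _ => E j)) -big_distrr /= -exprDn.
by rewrite subrK expr1n mulr1.
Qed.

Variables (I : finType) (t : I -> A).

Definition bern N (k : {ffun I -> 'I_N.+1}) : A :=
  \prod_i ('C(N, k i)%:R * t i ^+ k i * (1 - t i) ^+ (N - k i)).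

Lemma bern_factorial_moment N (a : I -> nat) : (forall i, a i <= N)%N ->
  \sum_(k : {ffun I -> 'I_N.+1}) (\prod_i 'C(k i, a i))%N%:R * bern k =
  (\prod_i 'C(N, a i))%N%:R * \prod_i t i ^+ a i.
Proof.
move=> aN; rewrite natr_prod -big_split /=.
rewrite -(eq_bigr _ (fun i _ => bernstein_factorial_moment (t i) (aN i))).
rewrite (bigA_distr_bigA (fun i (k : 'I_N.+1) =>
  'C(k, a i)%:R * ('C(N, k)%:R * t i ^+ k * (1 - t i) ^+ (N - k)))) /=.
by apply: eq_bigr => k _; rewrite natr_prod -big_split.
Qed.

End Bernstein.

(** Telescoping: replace one factor at a time, all the others being bounded by 1. *)
Lemma ler_norm_prodB (R : realFieldType) (I : Type) (s : seq I) (x y : I -> R) :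
  (forall i, `|x i| <= 1) -> (forall i, `|y i| <= 1) ->
  `|\prod_(i <- s) x i - \prod_(i <- s) y i| <= \sum_(i <- s) `|x i - y i|.
Proof.
move=> x1 y1; elim: s => [|i s IH]; first by rewrite !big_nil subrr normr0.
rewrite !big_cons.
have -> : x i * \prod_(j <- s) x j - y i * \prod_(j <- s) y j =
  (x i - y i) * \prod_(j <- s) x j +
  y i * (\prod_(j <- s) x j - \prod_(j <- s) y j) by ring.
apply: (le_trans (ler_normD _ _)); rewrite !normrM; apply: lerD.
  rewrite ler_piMr// normr_prod.
  by elim: s {IH} => [|j s IH]; rewrite ?big_nil// big_cons mulr_ile1// prodr_ge0.
by apply: le_trans IH; rewrite ler_piMl.
Qed.

(** * Moments of the discrete Bernstein measures *)

Section BernsteinMeasure.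
Variables (R : realFieldType) (I : finType).

(** The ratio is a product of a factors (k - j) / (N - j), each within a / N of k / N, whence a^2 /
    N. *)
Lemma binomial_ratio_approx k N a : (k <= N)%N -> (a <= N)%N -> (0 < N)%N ->
  `|'C(k, a)%:R / 'C(N, a)%:R - (k%:R / N%:R) ^+ a| <= (a ^ 2)%:R / N%:R :> R.
Proof.
move=> kN aN N0; have N0' : 0 < N%:R :> R by rewrite ltr0n.
(* Truncated subtraction is harmless: if k < a, the factor j = k vanishes, as does C(k, a). *)
have -> : 'C(k, a)%:R / 'C(N, a)%:R =
    \prod_(j < a) ((k - j)%:R / (N - j)%:R) :> R.
  have fe m : (\prod_(j < a) (m - j)%N%:R) = 'C(m, a)%:R * a`!%:R :> R.
    by rewrite -natr_prod -ffact_prod -bin_ffact natrM.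
  have a0 : a`!%:R != 0 :> R by rewrite pnatr_eq0 -lt0n fact_gt0.
  by rewrite big_split /= prodfV !fe invfM mulrACA divff// mulr1.
rewrite -[X in _ ^+ X](card_ord a) -prodr_const.
apply: (@le_trans _ _ (\sum_(j < a) a%:R / N%:R)); last first.
  by rewrite sumr_const card_ord -mulrnAl -mulrnA expnS expn1.
have kN1 : [&& (0 : R) <= k%:R / N%:R & k%:R / N%:R <= 1 :> R].
  by apply/andP; split; [rewrite divr_ge0|rewrite ler_pdivrMr// mul1r ler_nat].
have key (j : 'I_a) :
    [&& (0 : R) <= (k - j)%:R / (N - j)%:R & (k - j)%:R / (N - j)%:R <= 1 :> R] /\
    `|(k - j)%:R / (N - j)%:R - k%:R / N%:R| <= a%:R / N%:R :> R.
  have ja := ltn_ord j.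
  have jN : (j < N)%N by exact: leq_trans aN.
  have Nj0 : 0 < (N - j)%:R :> R by rewrite ltr0n subn_gt0.
  split.
    by apply/andP; split; [rewrite divr_ge0|rewrite ler_pdivrMr// mul1r ler_nat leq_sub2r].
  have ub : (k - j)%:R / (N - j)%:R <= k%:R / N%:R :> R.
    rewrite ler_pdivrMr// mulrAC ler_pdivlMr// -!natrM ler_nat.
    by rewrite mulnBl mulnBr leq_sub2l// mulnC leq_mul2l kN orbT.
  have lb : k%:R / N%:R - a%:R / N%:R <= (k - j)%:R / (N - j)%:R :> R.
    apply: (@le_trans _ _ ((k - j)%:R / N%:R)).
      by rewrite -mulrBl ler_pM2r ?invr_gt0// lerBlDr -natrD ler_nat; lia.
    apply: ler_wpM2l => //; by rewrite lef_pV2 ?posrE// ler_nat; lia.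
  rewrite ler_norml; move: ub lb; set u := _ / _; set v := _ / _; set w := _ / _; lra.
apply: le_trans (_ : _ <= \sum_(j < a) `|(k - j)%:R / (N - j)%:R - k%:R / N%:R|) _.
  apply: ler_norm_prodB => [j|_].
    by have [/andP[h1 h2] _] := key j; rewrite ger0_norm.
  by case/andP: kN1 => h1 h2; rewrite ger0_norm.
by apply: ler_sum => j _; have [] := key j.
Qed.

Variables (A : comNzRingType) (t : I -> A) (lam : A -> R).
Hypothesis lamD : forall p q, lam (p + q) = lam p + lam q.
Hypothesis lam_bern : forall N (k : {ffun I -> 'I_N.+1}), 0 <= lam (bern t k).

Let lam0 : lam 0 = 0.
Proof. by apply: (addrI (lam 0)); rewrite -lamD !addr0. Qed.

Let lam_sum (J : Type) (s : seq J) (F : J -> A) :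
  lam (\sum_(j <- s) F j) = \sum_(j <- s) lam (F j).
Proof. exact: (big_morph lam lamD lam0). Qed.

Let lamMn k p : lam (k%:R * p) = k%:R * lam p.
Proof.
rewrite !mulr_natl; elim: k => [|k IH]; first by rewrite !mulr0n lam0.
by rewrite !mulrS lamD IH.
Qed.

Lemma bern_mass N : \sum_(k : {ffun I -> 'I_N.+1}) lam (bern t k) = lam 1.
Proof.
have := @bern_factorial_moment A I t N (fun=> 0%N) (fun=> isT).
rewrite [X in _ = X -> _](_ : _ = 1); last first.
  rewrite big1 ?mul1r; last by move=> i _; rewrite bin0.
  by rewrite big1// => i _; rewrite expr0.
move=> <-; rewrite lam_sum; apply: eq_bigr => k _.
by rewrite big1 ?mul1r// => i _; rewrite bin0.
Qed.

(** The measure with mass [lam (bern t k)] at the grid point k / N has the right moments up to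
    O(1/N). The factorial moments are exact and involve only integer coefficients, so additivity of
    [lam] suffices; the error comes from passing to powers. *)
Lemma bern_moment N (a : I -> nat) : (forall i, a i <= N)%N -> (0 < N)%N ->
  `|\sum_(k : {ffun I -> 'I_N.+1})
      lam (bern t k) * \prod_i ((k i)%:R / N%:R) ^+ a i
    - lam (\prod_i t i ^+ a i)| <= lam 1 * (\sum_i a i ^ 2)%N%:R / N%:R.
Proof.
move=> aN N0.
pose D := (\prod_i 'C(N, a i))%N.
have D0 : D%:R != 0 :> R.
  by rewrite pnatr_eq0 -lt0n prodn_gt0// => i; rewrite bin_gt0.
(* The exact identity: powers of k / N are replaced by binomial ratios. *)
have -> : lam (\prod_i t i ^+ a i) = \sum_(k : {ffun I -> 'I_N.+1})
    lam (bern t k) * \prod_i ('C(k i, a i)%:R / 'C(N, a i)%:R).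
  apply: (mulfI D0); rewrite -lamMn -bern_factorial_moment// lam_sum mulr_sumr.
  apply: eq_bigr => k _; rewrite lamMn big_split /= prodfV -!natr_prod.
  by rewrite -/D; field.
rewrite -sumrB; apply: le_trans (ler_norm_sum _ _ _) _.
rewrite -(bern_mass N) -mulrA mulr_suml; apply: ler_sum => k _.
rewrite -mulrBr normrM ger0_norm//; apply: ler_wpM2l => //.
have kle i : (k i <= N)%N by rewrite -ltnS.
have N0' : 0 < N%:R :> R by rewrite ltr0n.
apply: le_trans (_ : _ <= \sum_i `|((k i)%:R / N%:R) ^+ a i -
                        'C(k i, a i)%:R / 'C(N, a i)%:R|) _.
  apply: ler_norm_prodB => i.
    have h : 0 <= (k i)%:R / N%:R :> R by rewrite divr_ge0.
    rewrite normrX exprn_ile1// ger0_norm// ler_pdivrMr// mul1r ler_nat//.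
  rewrite ger0_norm ?divr_ge0// ler_pdivrMr ?ltr0n ?bin_gt0// mul1r ler_nat.
  exact: leq_bin2l.
rewrite natr_sum mulr_suml; apply: ler_sum => i _.
by rewrite distrC; exact: binomial_ratio_approx.
Qed.

End BernsteinMeasure.

(** * The moment functional *)

Definition mnmi n (a : mi n) : multinom n := Multinom [tuple a i | i < n].

Lemma mnmiE n (a : mi n) i : mnmi a i = a i.
Proof. by rewrite /mnmi multinomE tnth_mktuple. Qed.

Section MomentFunctional.
Variables (C : numClosedFieldType) (n : nat).
Local Notation B := (mpoly (n + n) C).
Local Notation cst := (mpolyC (n + n) (R := C)).
Implicit Types (y : mi n -> mi n -> C).

Definition hpart (m : multinom (n + n)) : mi n := [ffun j => m (lshift n j)].
Definition apart (m : multinom (n + n)) : mi n := [ffun j => m (rshift n j)].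

Definition mono (a b : mi n) : B :=
  antP (mpolyX C (mnmi a)) * holP (mpolyX C (mnmi b)).

Lemma mpolyX_mono m : mpolyX C m = mono (apart m) (hpart m).
Proof.
rewrite mpolyXE_id big_split_ord /mono antPXm holPXm mulrC.
by congr (_ * _); apply: eq_bigr => j _; rewrite mnmiE ffunE.
Qed.

Definition joinm (a b : mi n) : multinom (n + n) :=
  Multinom [tuple (match fintype.split i with inl j => b j | inr j => a j end) | i < n + n].

Lemma apart_joinm a b : apart (joinm a b) = a.
Proof.
apply/ffunP => j; rewrite ffunE multinomE tnth_mktuple.
by rewrite -[rshift _ _]/(unsplit (inr j)) unsplitK.
Qed.

Lemma hpart_joinm a b : hpart (joinm a b) = b.
Proof.
apply/ffunP => j; rewrite ffunE multinomE tnth_mktuple.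
by rewrite -[lshift _ _]/(unsplit (inl j)) unsplitK.
Qed.

Lemma mono_mpolyX a b : mono a b = mpolyX C (joinm a b).
Proof. by rewrite mpolyX_mono apart_joinm hpart_joinm. Qed.

Lemma monoM a b c d : mono a b * mono c d = mono (maddi a c) (maddi b d).
Proof.
rewrite !mono_mpolyX -mpolyXD; congr mpolyX.
apply/mnmP => i; rewrite mnmDE !multinomE !tnth_mktuple.
by case: (fintype.split i) => j; rewrite ffunE.
Qed.

Lemma mono0 : mono (mzero n) (mzero n) = 1.
Proof.
rewrite mono_mpolyX -mpolyX0; congr mpolyX; apply/mnmP => i.
rewrite mnm0E multinomE tnth_mktuple.
by case: (fintype.split i) => j; rewrite ffunE.
Qed.

Definition riesz y (q : B) : C :=
  \sum_(m <- msupp q) mcoeff m q * y (apart m) (hpart m).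

(** The support varies with q; a common index set of bounded degree makes linearity a termwise
    matter. *)
Lemma rieszE y q k : (mmeasure mpoly.mdeg q <= k)%N ->
  riesz y q = \sum_(m : bmultinom (n + n) k) mcoeff m q * y (apart m) (hpart m).
Proof.
move=> le_qk; set I : subFinType _ := bmultinom (n + n) k.
rewrite /riesz (big_mksub I) ?msupp_uniq //=; first last.
  by move=> x /msize_mdeg_lt /leq_trans; apply.
rewrite big_rmcond //= => j /memN_msupp_eq0 ->.
by rewrite mul0r.
Qed.

Lemma riesz_is_additive y : additive (riesz y).
Proof.
move=> p q; pose k := maxn (mmeasure mpoly.mdeg (p - q))
  (maxn (mmeasure mpoly.mdeg p) (mmeasure mpoly.mdeg q)).
rewrite !(@rieszE y _ k) ?leq_maxl ?leq_max ?leqnn ?orbT//.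
by rewrite -sumrB; apply: eq_bigr => m _; rewrite raddfB /= mulrBl.
Qed.

HB.instance Definition _ y :=
  GRing.isAdditive.Build B C (riesz y) (riesz_is_additive y).

Lemma rieszZ y c q : riesz y (c *: q) = c * riesz y q.
Proof.
pose k := maxn (mmeasure mpoly.mdeg (c *: q)) (mmeasure mpoly.mdeg q).
rewrite !(@rieszE y _ k) ?leq_maxl ?leq_max ?leqnn ?orbT//.
by rewrite mulr_sumr; apply: eq_bigr => m _; rewrite mcoeffZ mulrA.
Qed.

Lemma rieszD y p q : riesz y (p + q) = riesz y p + riesz y q.
Proof. exact: (raddfD (riesz y)). Qed.

Lemma riesz_sum y (I : finType) (P : pred I) (F : I -> B) :
  riesz y (\sum_(i | P i) F i) = \sum_(i | P i) riesz y (F i).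
Proof. exact: (raddf_sum (riesz y)). Qed.

Lemma riesz_mono y a b : riesz y (mono a b) = y a b.
Proof.
by rewrite mono_mpolyX /riesz msuppX big_seq1 mcoeffX eqxx mul1r apart_joinm hpart_joinm.
Qed.

Definition ev (z : 'I_n -> C) (q : B) : C :=
  mmap idfun (fun i => match fintype.split i with inl j => z j
                                      | inr j => (z j)^* end) q.

Lemma ev_is_additive z : additive (ev z).
Proof. exact: mmap_is_additive. Qed.
Lemma ev_is_multiplicative z : multiplicative (ev z).
Proof. exact: mmap_is_multiplicative. Qed.
HB.instance Definition _ z :=
  GRing.isAdditive.Build B C (ev z) (ev_is_additive z).
HB.instance Definition _ z :=
  GRing.isMultiplicative.Build B C (ev z) (ev_is_multiplicative z).

Lemma evD z p q : ev z (p + q) = ev z p + ev z q.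
Proof. exact: (raddfD (ev z)). Qed.

Lemma evB z p q : ev z (p - q) = ev z p - ev z q.
Proof. exact: (raddfB (ev z)). Qed.

Lemma evM z p q : ev z (p * q) = ev z p * ev z q.
Proof. exact: (rmorphM (ev z)). Qed.

Lemma ev0 z : ev z 0 = 0.
Proof. exact: (raddf0 (ev z)). Qed.

Lemma evX z q k : ev z (q ^+ k) = ev z q ^+ k.
Proof. exact: (rmorphXn (ev z)). Qed.

Lemma ev_prod z (I : finType) (F : I -> B) : ev z (\prod_i F i) = \prod_i ev z (F i).
Proof. exact: (rmorph_prod (ev z)). Qed.

Lemma ev_sum z (I : finType) (P : pred I) (F : I -> B) :
  ev z (\sum_(i | P i) F i) = \sum_(i | P i) ev z (F i).
Proof. exact: (raddf_sum (ev z)). Qed.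

Lemma evZ z c q : ev z (c *: q) = c * ev z q.
Proof. by rewrite /ev mmapZ. Qed.

Lemma evC z c : ev z (cst c) = c.
Proof. by rewrite /ev mmapC. Qed.

Lemma ev_holX z j : ev z (holX C j) = z j.
Proof.
rewrite /ev mmapX mmap1U -[lshift _ _]/(unsplit (inl j)).
by rewrite unsplitK.
Qed.

Lemma ev_antX z j : ev z (antX C j) = (z j)^*.
Proof.
rewrite /ev mmapX mmap1U -[rshift _ _]/(unsplit (inr j)).
by rewrite unsplitK.
Qed.

(* Otherwise unification unfolds products of polynomials when rewriting. *)
Opaque ev riesz.

Lemma ev_mono z a b : ev z (mono a b) = \prod_j (z j)^* ^+ a j * \prod_j z j ^+ b j.
Proof.
rewrite /mono evM antPXm holPXm !ev_prod.
by congr (_ * _); apply: eq_bigr => j _; rewrite evX mnmiE ?ev_antX ?ev_holX.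
Qed.

Lemma ev_antP z P : ev z (antP P) = (ev z (holP P))^*.
Proof.
elim/mpolyind: P => [|c m p _ _ IH]; first by rewrite antP0 holP0 ev0 rmorph0.
rewrite antPD holPD 2!evD IH (rmorphD Num.conj); congr (_ + _).
rewrite antPZ holPZ 2!evZ (rmorphM Num.conj); congr (_ * _).
rewrite antPXm holPXm !ev_prod rmorph_prod; apply: eq_bigr => j _.
by rewrite !evX rmorphXn ev_antX ev_holX.
Qed.

Lemma conj_ev_mono z a b : (ev z (mono a b))^* = ev z (mono b a).
Proof. by rewrite /mono 2!evM 2!ev_antP (rmorphM Num.conj) /= conjCK mulrC. Qed.

Lemma ev_sqM_ge0 z P q : 0 <= ev z q -> 0 <= ev z (antP P * holP P * q).
Proof.
move=> q0; rewrite (evM _ (_ * _)) (evM _ (antP P)) ev_antP.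
by apply: mulr_ge0 => //; rewrite mulrC mul_conjC_ge0.
Qed.

Definition gpoly k (c : mi n -> mi n -> C) : B :=
  \sum_(g : bidx n k | bnd g) \sum_(h : bidx n k | bnd h)
    c (tomi g) (tomi h) *: mono (tomi g) (tomi h).

Lemma conj_ev_gpoly z k c : (forall a b, (c a b)^* = c b a) ->
  (ev z (gpoly k c))^* = ev z (gpoly k c).
Proof.
move=> ch; rewrite /gpoly ev_sum (rmorph_sum Num.conj).
transitivity (\sum_(g : bidx n k | bnd g) \sum_(h : bidx n k | bnd h)
   ev z (c (tomi h) (tomi g) *: mono (tomi h) (tomi g))).
  apply: eq_bigr => g _; rewrite ev_sum (rmorph_sum Num.conj); apply: eq_bigr => h _.
  by rewrite 2!evZ (rmorphM Num.conj) /= ch conj_ev_mono.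
by rewrite exchange_big; apply: eq_bigr => g _; rewrite ev_sum.
Qed.

Definition vpoly d (v : bidx n d -> C) : mpoly n C :=
  \sum_(b | bnd b) v b *: mpolyX C (mnmi (tomi b)).

(** Turns moment matrices into the functional: [v] is read as the coefficients of a holomorphic p,
    and the quadratic form becomes L(|p|^2 g). *)
Lemma mom_form d k c y (v : bidx n d -> C) :
  \sum_(a | bnd a) \sum_(b | bnd b)
     (v a)^* * (\sum_(g : bidx n k | bnd g) \sum_(h : bidx n k | bnd h)
        c (tomi g) (tomi h) * y (maddi (tomi a) (tomi g)) (maddi (tomi b) (tomi h))) * v b =
  riesz y (antP (vpoly v) * holP (vpoly v) * gpoly k c).
Proof.
have -> : antP (vpoly v) = \sum_(a | bnd a) (v a)^* *: antP (mpolyX C (mnmi (tomi a))).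
  by rewrite /vpoly antP_sum; apply: eq_bigr => a _; rewrite antPZ.
have -> : holP (vpoly v) = \sum_(a | bnd a) v a *: holP (mpolyX C (mnmi (tomi a))).
  by rewrite /vpoly holP_sum; apply: eq_bigr => a _; rewrite holPZ.
have E (a b : bidx n d) : riesz y (mono (tomi a) (tomi b) * gpoly k c) =
    \sum_(g : bidx n k | bnd g) \sum_(h : bidx n k | bnd h)
    c (tomi g) (tomi h) * y (maddi (tomi a) (tomi g)) (maddi (tomi b) (tomi h)).
  rewrite /gpoly mulr_sumr riesz_sum; apply: eq_bigr => g _.
  rewrite mulr_sumr riesz_sum; apply: eq_bigr => h _.
  by rewrite -scalerAr rieszZ monoM riesz_mono.
move: (gpoly k c) E => G E.
rewrite mulr_suml mulr_suml riesz_sum; apply: eq_bigr => a _.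
rewrite mulr_sumr mulr_suml riesz_sum; apply: eq_bigr => b _.
have -> (c1 c2 : C) (p q r : B) : c1 *: p * (c2 *: q) * r = (c1 * c2) *: (p * q * r).
  by rewrite -!mul_mpolyC rmorphM /=; move: (cst c1) (cst c2) => u u'; ring.
by rewrite rieszZ -/(mono _ _) E mulrAC.
Qed.

Lemma vpoly_surj (P : mpoly n C) : exists d (v : bidx n d -> C), P = vpoly v.
Proof.
(* For nonzero P this is one more than the degree; any bound on the degree would do. *)
pose d := mmeasure mpoly.mdeg P.
pose v (b : bidx n d) := mcoeff (mnmi (tomi b)) P.
exists d, v; apply/mpolyP => m; rewrite /vpoly raddf_sum /=.
have -> : \sum_(b : bidx n d | bnd b) mcoeff m (v b *: mpolyX C (mnmi (tomi b))) =
    \sum_(b : bidx n d | bnd b && (mnmi (tomi b) == m)) mcoeff m P.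
  rewrite big_mkcondr; apply: eq_bigr => b _.
  rewrite mcoeffZ mcoeffX /v; case: eqP => [->|_]; first by rewrite mulr1.
  by rewrite mulr0.
have [mP|mP] := boolP (m \in msupp P); last first.
  by rewrite (memN_msupp_eq0 mP) big1.
have mlt : (mpoly.mdeg m < d)%N by exact: msize_mdeg_lt.
have mi_lt (i : 'I_n) : (m i < d.+1)%N.
  rewrite ltnS; apply: leq_trans (ltnW mlt); rewrite mdegE (bigD1 i)//=.
  exact: leq_addr.
pose b0 : bidx n d := [ffun i => Ordinal (mi_lt i)].
have tb0 : mnmi (tomi b0) = m.
  by apply/mnmP => i; rewrite mnmiE !ffunE.
have bb0 : bnd b0.
  rewrite /bnd; apply: leq_trans (ltnW mlt); rewrite mdegE.
  by apply: leq_sum => i _; rewrite ffunE.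
rewrite (bigD1 b0) ?bb0 ?tb0 ?eqxx//= big1 ?addr0// => b /andP[/andP[_ /eqP bm]].
case/eqP; apply/ffunP => i; apply/val_inj.
by rewrite ffunE /= -bm mnmiE ffunE.
Qed.

Lemma riesz_ge0 k c y : 
  (forall d (v : bidx n d -> C), 0 <= \sum_(a | bnd a) \sum_(b | bnd b)
     (v a)^* * (\sum_(g : bidx n k | bnd g) \sum_(h : bidx n k | bnd h)
        c (tomi g) (tomi h) * y (maddi (tomi a) (tomi g)) (maddi (tomi b) (tomi h))) * v b) ->
  forall P, 0 <= riesz y (antP P * holP P * gpoly k c).
Proof.
by move=> h P; have [d [v ->]] := vpoly_surj P; rewrite -mom_form; exact: h.
Qed.

(** Complex polarization: P + Q makes the sum of the two cross terms vanish, P + iQ their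
    difference. *)
Lemma polarization_eq0 (L : B -> C) :
  (forall p q, L (p + q) = L p + L q) -> (forall c p, L (c *: p) = c * L p) ->
  (forall P, L (antP P * holP P) = 0) -> forall P Q, L (antP P * holP Q) = 0.
Proof.
move=> LD LZ L0 P Q.
have E (a b c d : B) : L ((a + b) * (c + d)) = L (a * c) + L (a * d) + (L (b * c) + L (b * d)).
  by rewrite mulrDl !mulrDr (LD (_ + _)) (LD (a * c)) (LD (b * c)).
have EZ (c : C) (a b : B) : L (c *: a * b) = c * L (a * b) /\ L (a * (c *: b)) = c * L (a * b).
  by rewrite -scalerAl -scalerAr !(LZ c).
have e1 := L0 (P + Q); have e2 := L0 (P + 'i *: Q).
move: e1; rewrite antPD holPD E (L0 P) (L0 Q) add0r addr0 => e1.
move: e2; rewrite antPD holPD antPZ holPZ E (L0 P) add0r.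
rewrite (EZ _ (antP P) _).2 (EZ _ (antP Q) (holP P)).1 (EZ _ (antP Q) _).1.
rewrite (EZ _ (antP Q) (holP Q)).2 (L0 Q) !mulr0 addr0 conjCi => e2.
have : 'i * (L (antP P * holP Q) + L (antP P * holP Q)) = 0.
  have -> : L (antP P * holP Q) + L (antP P * holP Q) =
    (L (antP P * holP Q) + L (antP Q * holP P)) +
    (L (antP P * holP Q) - L (antP Q * holP P)) by ring.
  by rewrite e1 add0r mulrBr -e2 mulNr.
move/eqP; rewrite mulf_eq0 (negbTE (neq0Ci _)) /= -mulr2n mulrn_eq0 /=.
by move/eqP.
Qed.

Lemma mono_ind (Pr : B -> Prop) :
  Pr 0 -> (forall c a b q, Pr q -> Pr (c *: mono a b + q)) -> forall q, Pr q.
Proof.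
move=> P0 PD; elim/mpolyind => // c m q _ _ IH.
by rewrite mpolyX_mono; exact: PD.
Qed.

(** Every monomial zbar^a z^b is a cross term of two holomorphic monomials. This upgrades L(|P|^2 s)
    = 0, all that the two sphere constraints give, to L(q s) = 0 for all q. *)
Lemma sesquilinear_eq0 (L : B -> C) :
  (forall p q, L (p + q) = L p + L q) -> (forall c p, L (c *: p) = c * L p) ->
  (forall P, L (antP P * holP P) = 0) -> forall q, L q = 0.
Proof.
move=> LD LZ L0; elim/mono_ind => [|c a b q IH].
  by rewrite -(scale0r 0) LZ mul0r.
by rewrite LD LZ IH /mono (polarization_eq0 LD LZ L0) mulr0 addr0.
Qed.

End MomentFunctional.
Opaque ev riesz.

(** * Cube coordinates and constraint polynomials *)

Section CubeCoordinates.
Variables (C : numClosedFieldType) (n : nat) (r : C).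
Hypothesis r0 : 0 < r.
Local Notation B := (mpoly (n + n) C).
Local Notation cst := (mpolyC (n + n) (R := C)).

Definition affine_form (u : C) (j : 'I_n) : B :=
  cst (r *+ 2) + cst u * holX C j + cst u^* * antX C j.

(** These are (r + Re z_j) / 2r and (r + Im z_j) / 2r, which map [-r, r] onto [0, 1]; for u = -i the
    affine form is 2r + 2 Im z_j. *)
Definition cubeX (i : 'I_(n + n)) : B :=
  match fintype.split i with
  | inl j => (r *+ 4)^-1 *: affine_form 1 j
  | inr j => (r *+ 4)^-1 *: affine_form (- 'i) j
  end.

Let r4 : 0 <= (r *+ 4)^-1. Proof. by rewrite invr_ge0 mulrn_wge0// ltW. Qed.

Lemma sos_cubeX i : sos r (cubeX i).
Proof.
rewrite /cubeX; case: (fintype.split i) => j; apply: sosZ => //; apply: sos_affine => //.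
  by rewrite conjC1 mulr1.
  by rewrite rmorphN /= conjCi opprK mulNr -expr2 sqrCi opprK.
Qed.

(** By this symmetry [1 - cubeX i] is again a multiple of an affine form, so both faces of the cube
    are handled by [sos_affine]. *)
Lemma affine_formN u j : cst (r *+ 4) - affine_form u j = affine_form (- u) j.
Proof.
rewrite /affine_form (rmorphN Num.conj) !(rmorphN cst).
rewrite (_ : r *+ 4 = r *+ 2 + r *+ 2) ?rmorphD /=.
  by move: (cst _) (cst _) (cst _) => *; ring.
by rewrite -mulrnDr.
Qed.

Lemma sos_1subcubeX i : sos r (1 - cubeX i).
Proof.
have e (x : B) : 1 - (r *+ 4)^-1 *: x = (r *+ 4)^-1 *: (cst (r *+ 4) - x).
  rewrite scalerBr; congr (_ - _).
  by rewrite -mul_mpolyC -rmorphM mulVf ?rmorph1// mulrn_eq0 /= gt_eqF.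
rewrite /cubeX; case: (fintype.split i) => j; rewrite e affine_formN; apply: sosZ => //;
  apply: sos_affine => //.
  by rewrite (rmorphN Num.conj) /= conjC1 mulrNN mulr1.
by rewrite opprK conjCi mulrN -expr2 sqrCi opprK.
Qed.

Lemma sos_bern N (k : {ffun 'I_(n + n) -> 'I_N.+1}) : sos r (bern cubeX k).
Proof.
apply: sos_prod => i _; apply: sosM; last exact/sosX/sos_1subcubeX.
by apply: sosM; [rewrite -(rmorph_nat cst); exact: sosC|exact/sosX/sos_cubeX].
Qed.

Lemma cubeX_l j : cubeX (lshift n j) = (r *+ 4)^-1 *: affine_form 1 j.
Proof. by rewrite /cubeX -[lshift _ _]/(unsplit (inl j)) unsplitK. Qed.

Lemma cubeX_r j : cubeX (rshift n j) = (r *+ 4)^-1 *: affine_form (- 'i) j.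
Proof. by rewrite /cubeX -[rshift _ _]/(unsplit (inr j)) unsplitK. Qed.

Let affine_form_cubeX_l j : affine_form 1 j = (r *+ 4) *: cubeX (lshift n j).
Proof. by rewrite cubeX_l scalerA divff ?scale1r// mulrn_eq0 /= gt_eqF. Qed.

Let affine_form_cubeX_r j : affine_form (- 'i) j = (r *+ 4) *: cubeX (rshift n j).
Proof. by rewrite cubeX_r scalerA divff ?scale1r// mulrn_eq0 /= gt_eqF. Qed.

Let cst2 : cst (2%:R^-1) * (1 + 1) = 1.
Proof. by rewrite -[1 + 1]/(2%:R) -(rmorph_nat cst) -rmorphM mulVf ?rmorph1// pnatr_eq0. Qed.

Let csti2 : cst 'i * cst 'i = - 1.
Proof. by rewrite -rmorphM -expr2 sqrCi rmorphN rmorph1. Qed.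

Let cstNi : cst (- 'i) = - cst 'i. Proof. exact: rmorphN. Qed.

Lemma holX_cubeX j : holX C j = cst (2%:R^-1) *
  (cst (r *+ 4) * cubeX (lshift n j) - cst (r *+ 2) +
   cst 'i * (cst (r *+ 4) * cubeX (rshift n j) - cst (r *+ 2))).
Proof.
rewrite !mul_mpolyC -affine_form_cubeX_l -affine_form_cubeX_r -!mul_mpolyC.
rewrite /affine_form conjC1 (rmorphN Num.conj) /= conjCi opprK (rmorph1 cst) cstNi.
move: (cst (2%:R^-1)) (cst 'i) (cst (r *+ 2)) (holX C j) (antX C j) cst2 csti2.
move=> h i c z zb e1 e2.
transitivity (h * (z + zb - (i * i) * (z - zb))); last by ring.
by rewrite e2; transitivity (h * (1 + 1) * z); [rewrite e1 mul1r|ring].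
Qed.

Lemma antX_cubeX j : antX C j = cst (2%:R^-1) *
  (cst (r *+ 4) * cubeX (lshift n j) - cst (r *+ 2) -
   cst 'i * (cst (r *+ 4) * cubeX (rshift n j) - cst (r *+ 2))).
Proof.
rewrite !mul_mpolyC -affine_form_cubeX_l -affine_form_cubeX_r -!mul_mpolyC.
rewrite /affine_form conjC1 (rmorphN Num.conj) /= conjCi opprK (rmorph1 cst) cstNi.
move: (cst (2%:R^-1)) (cst 'i) (cst (r *+ 2)) (holX C j) (antX C j) cst2 csti2.
move=> h i c z zb e1 e2.
transitivity (h * (z + zb + (i * i) * (z - zb))); last by ring.
by rewrite e2; transitivity (h * (1 + 1) * zb); [rewrite e1 mul1r|ring].
Qed.

(** The cube coordinates generate the whole algebra, as z_j and zbar_j are affine in them; hence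
    identities need only be checked on their monomials. *)
Lemma cubeX_ind (Pr : B -> Prop) :
  Pr 1 -> (forall p q, Pr p -> Pr q -> Pr (p + q)) ->
  (forall c p, Pr p -> Pr (c *: p)) ->
  (forall i p, Pr p -> Pr (cubeX i * p)) ->
  forall q, Pr q.
Proof.
move=> P1 PD PZ PX.
have PC c p : Pr p -> Pr (cst c * p) by rewrite mul_mpolyC; exact: PZ.
have PN p : Pr p -> Pr (- p) by rewrite -scaleN1r; exact: PZ.
have Pgen i p : Pr p -> Pr (mpolyX C (mnm1 i) * p).
  move=> Pp; rewrite -(splitK i); case: (fintype.split i) => j.
    rewrite [unsplit _]/= -/(holX C j) holX_cubeX.
    rewrite -mulrA; apply: (PC); rewrite mulrDl; apply: (PD);
      last rewrite -mulrA; [|apply: (PC)];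
      rewrite mulrBl; apply: (PD); try (by apply/PN/PC); rewrite -mulrA; exact/PC/PX.
  rewrite [unsplit _]/= -/(antX C j) antX_cubeX.
  rewrite -mulrA; apply: (PC); rewrite mulrBl; apply: (PD);
    last (apply: (PN); rewrite -mulrA); [|apply: (PC)];
    rewrite mulrBl; apply: (PD); try (by apply/PN/PC); rewrite -mulrA; exact/PC/PX.
elim/mpolyind => [|c m q _ _ IH]; first by rewrite -(scale0r 1); exact: PZ.
apply: (PD) => //; apply: (PZ); rewrite mpolyXE_id.
elim/big_rec: _ => // i p _ Pp; elim: (m i) => [|l IHl]; first by rewrite mul1r.
by rewrite exprS -mulrA; exact: Pgen.
Qed.

End CubeCoordinates.

(** * The constraint polynomials: boundedness, the sphere, and g_0 *)

Section Constraints.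
Variables (C : numClosedFieldType) (n : nat).
Local Notation B := (mpoly (n + n) C).
Local Notation cst := (mpolyC (n + n) (R := C)).

Lemma sos_bounded_gpoly (r : C) k (c : mi n -> mi n -> C) : 0 < r ->
  (forall a b, (c a b)^* = c b a) -> sos_bounded r (gpoly k c).
Proof.
move=> r0 ch.
(* Averaging the double sum with its transpose pairs each term with its conjugate, the shape bounded
   by [sos_bounded_herm]. *)
have -> : gpoly k c = 2%:R^-1 *:
    \sum_(g : bidx n k | bnd g) \sum_(h : bidx n k | bnd h)
    (c (tomi g) (tomi h) *: mono C (tomi g) (tomi h) +
     (c (tomi g) (tomi h))^* *: mono C (tomi h) (tomi g)).
  under eq_bigr do rewrite big_split /=.
  rewrite big_split /= [X in _ + X]exchange_big /=.
  under [X in _ + X]eq_bigr do under eq_bigr do rewrite ch.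
  by rewrite -/(gpoly k c) -mulr2n -[X in _ *: X]scaler_nat scalerA mulVf ?scale1r// pnatr_eq0.
apply: sos_boundedZ; first by rewrite invr_ge0.
apply: sos_bounded_sum => g _; apply: sos_bounded_sum => h _.
exact: sos_bounded_herm.
Qed.

Lemma tomi_inj d : injective (@tomi n d).
Proof.
move=> a b /ffunP ab; apply/ffunP => j; apply/val_inj.
by have := ab j; rewrite !ffunE.
Qed.

Lemma bnd_tomi d (a : bidx n d) : bnd a = (mdeg (tomi a) <= d)%N.
Proof. by rewrite /bnd /mdeg; congr (_ <= _)%N; apply: eq_bigr => j _; rewrite ffunE. Qed.

Definition unitmi (j : 'I_n) : mi n := [ffun i => (i == j) : nat].

Lemma mdeg_unitmi j : mdeg (unitmi j) = 1%N.
Proof.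
rewrite /mdeg (bigD1 j)//= ffunE eqxx big1// => i ij.
by rewrite ffunE (negbTE ij).
Qed.

Lemma mdeg1E (a : mi n) : mdeg a = 1%N -> exists j, a = unitmi j.
Proof.
rewrite /mdeg => /eqP/sum_nat_eq1[j [_ aj a0]]; exists j; apply/ffunP => i.
by rewrite ffunE; case: (eqVneq i j) => [->|ij]; [rewrite aj|rewrite a0].
Qed.

Lemma mdeg_mzero : mdeg (mzero n) = 0%N.
Proof. by rewrite /mdeg big1// => j _; rewrite ffunE. Qed.

Lemma mono_unitmi j : mono C (unitmi j) (unitmi j) = antX C j * holX C j.
Proof.
rewrite /mono antPXm holPXm; congr (_ * _); rewrite (bigD1 j)//= mnmiE ffunE eqxx.
  by rewrite expr1 big1 ?mulr1// => i ij; rewrite mnmiE ffunE (negbTE ij) expr0.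
by rewrite expr1 big1 ?mulr1// => i ij; rewrite mnmiE ffunE (negbTE ij) expr0.
Qed.

Lemma tomi_surj d (a : mi n) : (mdeg a <= d)%N -> exists2 b : bidx n d, bnd b & tomi b = a.
Proof.
move=> ad.
have alt j : (a j < d.+1)%N.
  by rewrite ltnS; apply: leq_trans ad; rewrite /mdeg (bigD1 j)//= leq_addr.
have ta : tomi [ffun j => Ordinal (alt j)] = a.
  by apply/ffunP => j; rewrite !ffunE.
by exists [ffun j => Ordinal (alt j)]; rewrite ?bnd_tomi ta.
Qed.

(** With k = 0 the truncated sum would miss the terms |z_j|^2, hence the condition on k. *)
Lemma gpoly_sphere k (r : C) (c : mi n -> mi n -> C) : (0 < k)%N ->
  (forall a b, c a b = if (a == mzero n) && (b == mzero n) then r ^+ 2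
     else if (a == b) && (mdeg a == 1)%N then -1 else 0) ->
  gpoly k c = sphP n r.
Proof.
move=> k0 cE.
have -> : gpoly k c =
    \sum_(g : bidx n k | bnd g) c (tomi g) (tomi g) *: mono C (tomi g) (tomi g).
  apply: eq_bigr => g bg; rewrite (bigD1 g)//= big1 ?addr0// => h /andP[_ hg].
  have tgh : tomi g != tomi h.
    by apply: contraNneq hg => /tomi_inj ->.
  rewrite cE (negbTE tgh) /=; case: ifP => [/andP[/eqP e1 /eqP e2]|_].
    by rewrite e1 e2 eqxx in tgh.
  by rewrite scale0r.
have [|z bz tz] := @tomi_surj k (mzero n); first by rewrite mdeg_mzero.
rewrite (bigD1 z)//= tz cE eqxx /= mono0 -mul_mpolyC mulr1 /sphP; congr (_ + _).
have ex j : exists b : bidx n k, bnd b /\ tomi b = unitmi j.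
  by have [|b ? ?] := @tomi_surj k (unitmi j); [rewrite mdeg_unitmi|exists b].
have [e eP] := choice ex.
have einj : injective e.
  move=> i j eij; have := (eP i).2; rewrite eij (eP j).2 => /ffunP/(_ i).
  by rewrite !ffunE eqxx; case: eqP.
rewrite (bigID (fun g : bidx n k => mdeg (tomi g) == 1%N)) /=.
rewrite [X in _ + X]big1 ?addr0; last first.
  move=> g /andP[/andP[_ gz] g1]; rewrite cE (negbTE g1) andbF.
  have -> : (tomi g == mzero n) = false.
    by apply/negbTE; apply: contraNneq gz; rewrite -tz => /tomi_inj ->.
  by rewrite scale0r.
rewrite -sumrN (eq_bigl (fun g => g \in e @: [set: 'I_n]%SET)); last first.
  move=> g; apply/idP/imsetP => [/andP[_ /eqP/mdeg1E[j gj]]|[j _ ->]].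
    by exists j; rewrite ?inE//; apply: (@tomi_inj k); rewrite (eP j).2.
  have [bj tj] := eP j; rewrite bj tj mdeg_unitmi eqxx !andbT.
  apply/eqP => ez; move: tj; rewrite ez tz => h.
  by have := mdeg_unitmi j; rewrite -h mdeg_mzero.
rewrite big_imset /=; last by move=> i j _ _; exact: einj.
rewrite (eq_bigl xpredT); last by move=> j; rewrite inE.
apply: eq_bigr => j _; rewrite (eP j).2 cE mdeg_unitmi !eqxx /= mono_unitmi.
have -> : (unitmi j == mzero n) = false.
  by apply/eqP => h; have := mdeg_unitmi j; rewrite h mdeg_mzero.
by rewrite scaleN1r.
Qed.

Lemma gpolyN k (c : mi n -> mi n -> C) : gpoly k (fun a b => - c a b) = - gpoly k c.
Proof.
rewrite /gpoly -sumrN; apply: eq_bigr => g _.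
by rewrite -sumrN; apply: eq_bigr => h _; rewrite scaleNr.
Qed.

Lemma gpoly_one :
  gpoly 0 (fun a b : mi n => if (a == mzero n) && (b == mzero n) then 1 else 0) = 1 :> B.
Proof.
have t0 (g : bidx n 0) : tomi g = mzero n.
  by apply/ffunP => j; rewrite !ffunE; case: (g j) => -[].
have [|z bz _] := @tomi_surj 0 (mzero n); first by rewrite mdeg_mzero.
have gz (g : bidx n 0) : g = z by apply: (@tomi_inj 0); rewrite !t0.
rewrite /gpoly (bigD1 z)//= [X in _ + X]big1 ?addr0; last first.
  by move=> g /andP[_]; rewrite (gz g) eqxx.
rewrite (bigD1 z)//= [X in _ + X]big1 ?addr0; last first.
  by move=> g /andP[_]; rewrite (gz g) eqxx.
by rewrite t0 eqxx /= mono0 scale1r.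
Qed.

End Constraints.

Local Open Scope classical_set_scope.

(** * Binary boxes of the unit cube *)

Section Words.
Variables (R : realType) (p : nat).
Local Notation q := p.+1.

(* Words are stored with the most recent letter first. *)
Fixpoint word (theta : seq bool -> bool) (l : nat) : seq bool :=
  if l is l'.+1 then theta (word theta l') :: word theta l' else [::].

Lemma size_word theta l : size (word theta l) = l.
Proof. by elim: l => //= l ->. Qed.

(** Directions are halved cyclically, so after h rounds of q cuts every side has length 2^-h. *)
Definition coord_at (s : nat) : 'I_q := inord (s %% q).

Fixpoint width (l : nat) (i : 'I_q) : R :=
  if l is l'.+1 then (if coord_at l' == i then width l' i / 2 else width l' i) else 1.

Fixpoint corner (w : seq bool) (i : 'I_q) : R :=
  if w is b :: w' then
    corner w' i + (if b && (coord_at (size w') == i) then width (size w') i / 2 else 0)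
  else 0.

Lemma width_ge0 l i : 0 <= width l i.
Proof. by elim: l => //= l IH; case: ifP => // _; rewrite divr_ge0. Qed.

Lemma width_cycle h j i : (j <= q)%N ->
  width (h * q + j) i = width (h * q) i * (if (i < j)%N then 2^-1 else 1).
Proof.
elim: j => [|j IHj] jq; first by rewrite addn0 mulr1.
rewrite addnS /= (IHj (ltnW jq)).
have -> : (coord_at (h * q + j) == i) = (j == i :> nat).
  by rewrite /coord_at -val_eqE /= modnMDl modn_small// inordK.
have [ji|ji] := eqVneq j (i : nat); first by rewrite ji ltnn ltnSn mulr1.
by have -> : (i < j.+1)%N = (i < j)%N by apply/idP/idP; lia.
Qed.

Lemma width_round h i : width (h * q) i = (2^-1) ^+ h.
Proof.
elim: h => [//|h IH].
by rewrite mulSn addnC width_cycle// ltn_ord IH exprSr.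
Qed.

Lemma corner_ge0 w i : 0 <= corner w i.
Proof.
by elim: w => //= b w IH; rewrite addr_ge0//; case: ifP => // _; rewrite divr_ge0 ?width_ge0.
Qed.

Lemma corner_cons b w i : corner w i <= corner (b :: w) i.
Proof. by rewrite /= lerDl; case: ifP => // _; rewrite divr_ge0 ?width_ge0. Qed.

Lemma upper_corner_cons b w i :
  corner (b :: w) i + width (size w).+1 i <= corner w i + width (size w) i.
Proof.
have := width_ge0 (size w) i.
by rewrite /=; case: b; case: eqP => _ /=; set x := corner _ _; set y := width _ _; lra.
Qed.

Lemma upper_corner_le1 w i : corner w i + width (size w) i <= 1.
Proof.
elim: w => [|b w IH]; first by rewrite /= add0r.
exact: le_trans (upper_corner_cons _ _ _) IH.
Qed.

Section Limit.
Variable theta : seq bool -> bool.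

Lemma corner_word_le l k i : corner (word theta l) i <= corner (word theta (k + l)) i.
Proof. by elim: k => // k IH; apply: le_trans IH _; exact: corner_cons. Qed.

Lemma upper_corner_word_le l k i :
  corner (word theta (k + l)) i + width (k + l) i <= corner (word theta l) i + width l i.
Proof.
elim: k => // k IH; apply: le_trans IH.
have := upper_corner_cons (theta (word theta (k + l))) (word theta (k + l)) i.
by rewrite size_word.
Qed.

Definition word_limit i := sup (range (fun l => corner (word theta l) i)).

(** The boxes are nested, so every lower corner lies below every upper corner. The bounds are closed
    on both sides, as the limit may fall on an upper face. *)
Lemma corner_word_limit l i :
  corner (word theta l) i <= word_limit i <= corner (word theta l) i + width l i.
Proof.
have ub l' : corner (word theta l') i <= corner (word theta l) i + width l i.
  have [ll|/ltnW ll] := leqP l l'.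
    have := upper_corner_word_le l (l' - l) i; have := width_ge0 (l' - l + l) i.
    by rewrite subnK//; lra.
  have := corner_word_le l' (l - l') i; have := width_ge0 l i.
  by rewrite subnK//; lra.
apply/andP; split.
  apply: ub_le_sup; last by exists l.
  by exists (corner (word theta l) i + width l i) => _ [l' _ <-].
by apply: ge_sup; [exists (corner (word theta 0) i); exists 0%N|move=> _ [l' _ <-]].
Qed.

Lemma word_limit_itv i : 0 <= word_limit i <= 1.
Proof. by have := corner_word_limit 0 i; rewrite /= add0r. Qed.

Lemma corner_word_cvg i : corner (word theta (h * q)) i @[h --> \oo] --> word_limit i.
Proof.
apply: (@squeeze_cvgr _ _ _ _ (fun h => word_limit i - (2^-1) ^+ h) (fun=> word_limit i)).
- near=> h; have := corner_word_limit (h * q) i; rewrite width_round => /andP[-> ].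
  by rewrite lerBlDr => ->.
- rewrite -[X in _ --> X]subr0; apply: cvgB; first exact: cvg_cst.
  by apply: cvg_expr; rewrite ger0_norm ?invr_ge0// invf_lt1// ltr1n.
- exact: cvg_cst.
Unshelve. all: by end_near. Qed.

End Limit.

(* Greedy binary digits: the point 1 gets the expansion with all digits 1. *)
Definition digit (x : 'I_q -> R) (w : seq bool) : bool :=
  corner w (coord_at (size w)) + width (size w) (coord_at (size w)) / 2
    <= x (coord_at (size w)).

Let digitE x w : digit x w =
  (corner w (coord_at (size w)) + width (size w) (coord_at (size w)) / 2
    <= x (coord_at (size w))).
Proof. by []. Qed.

Lemma digit_bounds x : (forall i, 0 <= x i <= 1) ->
  forall l i, corner (word (digit x) l) i <= x i <= corner (word (digit x) l) i + width l i.
Proof.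
move=> x01; elim=> [|l IH] i; first by rewrite /= add0r.
rewrite /= !size_word; have := IH i; case: eqP => [<-|_]; last first.
  by rewrite andbF addr0.
rewrite andbT digitE size_word; set u := corner _ _; set v := width _ _.
by move=> /andP[h1 h2]; case: (leP (u + v / 2) _) => h; apply/andP; split; lra.
Qed.

End Words.

(** * Realising a mass distribution on binary words *)

(** Integral, for the mass distribution m, of the step function given by f on the descendants of w
    that are l generations below it. *)
Fixpoint tsum (R : realType) (m f : seq bool -> R) (l : nat) (w : seq bool) : R :=
  if l is l'.+1 then tsum m f l' (false :: w) + tsum m f l' (true :: w)
  else f w * m w.

Section TreeMeasure.
Variables (R : realType) (m : seq bool -> R).
Hypothesis m0 : forall w, 0 <= m w.
Hypothesis mD : forall w, m w = m (false :: w) + m (true :: w).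

Fixpoint cell_left (w : seq bool) : R :=
  if w is b :: w' then cell_left w' + (if b then m (false :: w') else 0) else 0.

(** Half-open intervals, so that the two children partition their parent exactly; a word of mass 0
    gets the empty cell. *)
Definition cell (w : seq bool) : set (measurableTypeR R) :=
  `[cell_left w, cell_left w + m w[%classic.

(** The path that t follows down the tree. It is defined for every real t; outside the root cell its
    values are arbitrary, and [treemu] gives no mass there. *)
Definition branch (t : R) (w : seq bool) : bool := cell_left w + m (false :: w) <= t.

Lemma cellU w : cell w = cell (false :: w) `|` cell (true :: w).
Proof.
have := m0 (false :: w); have := m0 (true :: w); have := mD w.
rewrite /cell /= !addr0; set u := cell_left w; set x := m w; set y := m _; set z := m _.
move=> e z0 y0; apply/seteqP; split => t /=; rewrite !in_itv /=.
  move=> /andP[h1 h2]; case: (ltP t (u + y)) => h; [left|right].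
    by rewrite h1.
  by apply/andP; split; lra.
by case=> /andP[h1 h2]; apply/andP; split; lra.
Qed.

Lemma cell_disj w : [disjoint cell (false :: w) & cell (true :: w)].
Proof.
apply/disj_setPS => t [] /=; rewrite /cell /= !in_itv /= addr0.
by move=> /andP[_ h] /andP[]; rewrite leNgt h.
Qed.

Lemma measurable_cell w : measurable (cell w).
Proof. exact: measurable_itv. Qed.

Lemma cell_sub w b : cell (b :: w) `<=` cell w.
Proof. by rewrite (cellU w); case: b; [exact: subsetUr|exact: subsetUl]. Qed.

Lemma word_cell w t : cell w t -> word (branch t) (size w) = w.
Proof.
elim: w => [//|b w IH] h; rewrite /= (IH (cell_sub h)); congr (_ :: _).
move: h; rewrite /cell /branch /= in_itv /=.
by case: b => /andP[]; rewrite ?addr0// => _ h; apply/negbTE; rewrite -ltNge.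
Qed.

Definition treemu := mrestr (@lebesgue_measure R) (measurable_cell [::]).

HB.instance Definition _ := measure_function.Measure.on treemu.

Lemma cell_sub0 w : cell w `<=` cell [::].
Proof. by elim: w => // b w IH; apply: subset_trans IH; exact: cell_sub. Qed.

Lemma treemu_cell w : treemu (cell w) = (m w)%:E.
Proof.
rewrite /treemu /mrestr setIidl; last exact: cell_sub0.
rewrite /cell lebesgue_measure_itv /= lte_fin ltrDl.
have := m0 w; rewrite le_eqVlt => /predU1P[<-|->]; first by rewrite ltxx.
by rewrite -EFinD addrAC subrr add0r.
Qed.

Lemma treemu_setT : treemu setT = (m [::])%:E.
Proof. by rewrite -treemu_cell /treemu /mrestr setTI setIid. Qed.

(** Induction with f generalized: the threshold that decides the next letter is itself a function of
    the word read so far. *)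
Lemma measurable_word (f : seq bool -> R) l :
  measurable_fun setT (fun t : measurableTypeR R => f (word (branch t) l)).
Proof.
elim: l f => [|l IH] f; first exact: (measurable_cst (f [::])).
have -> : (fun t : measurableTypeR R => f (word (branch t) l.+1)) =
   (fun t => if branch t (word (branch t) l) then f (true :: word (branch t) l)
             else f (false :: word (branch t) l)).
  by apply/funext => t /=; case: (branch t _).
apply: measurable_fun_ifT.
- apply: measurable_fun_ler; last exact: measurable_id.
  exact: (IH (fun w => cell_left w + m (false :: w))).
- exact: (IH (fun w => f (true :: w))).
- exact: (IH (fun w => f (false :: w))).
Qed.

Lemma integrable_bounded (f : measurableTypeR R -> R) (c : R) D : measurable D ->
  measurable_fun setT f -> (forall t, `|f t| <= c) ->
  treemu.-integrable D (EFin \o f).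
Proof.
move=> mDD mf fc; apply: measurable_bounded_integrable => //.
- rewrite (@le_lt_trans _ _ (treemu setT))//.
    by apply: le_measure; rewrite ?inE.
  by rewrite treemu_setT ltry.
- exact: measurable_funTS.
- exists c; split; first exact: num_real.
  by move=> x cx t _ /=; exact: le_trans (fc t) (ltW cx).
Qed.

(** Cutting a cell into its children follows the recursion of [tsum]; at depth 0 the integrand is
    constant by [word_cell]. *)
Lemma Rintegral_word (f : seq bool -> R) (c : R) l w : (forall w, `|f w| <= c) ->
  \int[treemu]_(t in cell w) f (word (branch t) (l + size w)) = tsum m f l w.
Proof.
move=> fc; elim: l w => [|l IH] w.
  rewrite (@eq_Rintegral _ _ _ _ _ (cst (f w))); last first.
    by move=> t /set_mem wt /=; rewrite add0n word_cell.
  by rewrite Rintegral_cst; [rewrite /= treemu_cell|exact: measurable_itv].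
rewrite cellU Rintegral_setU//; last first.
- exact: cell_disj.
- rewrite -cellU; apply: (integrable_bounded (c := c)) => //.
  + exact: measurable_cell.
  + exact: (measurable_word f (l.+1 + size w)).
- exact: measurable_cell.
- exact: measurable_cell.
by rewrite /= -!IH /= !addnS.
Qed.

Lemma Rintegral_treemu (f : measurableTypeR R -> R) (c : R) :
  measurable_fun setT f -> (forall t, `|f t| <= c) ->
  \int[treemu]_t f t = \int[treemu]_(t in cell [::]) f t.
Proof.
move=> mf fc; rewrite /Rintegral; congr fine.
have mc := measurable_cell [::].
rewrite (negligible_integral (measurableC mc) measurableT); last 2 first.
- exact: (integrable_bounded (c := c)).
- by rewrite /= /treemu /mrestr setICl measure0.
by rewrite setDE setCK setTI.
Qed.

End TreeMeasure.

(** * Weak limits of discrete measures and the Hausdorff moment problem *)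

(** A cluster point of an ultrafilter is a limit, so compactness suffices. One ultrafilter makes all
    box masses converge at once, without a diagonal extraction. *)
Lemma ultra_cvg (R : realType) (T : Type) (U : set_system T) (u : T -> R) a b :
  UltraFilter U -> (forall t, a <= u t <= b) ->
  exists2 l, a <= l <= b & u t @[t --> U] --> l.
Proof.
move=> UU uab.
have UF : ProperFilter U by exact: ultra_proper.
have UA : (u t @[t --> U]) `[a, b].
  by apply: (@filterE _ U) => t; rewrite /= in_itv; exact: uab.
have [l [lab lcl]] := @segment_compact R a b _ _ UA.
exists l; first by move: lab; rewrite /= in_itv.
move=> C lC; have [//|nC] := in_ultra_setVsetC (u @^-1` C) UU.
have [y [/= yC yC']] := lcl (~` C) C nC lC.
by case: (yC yC').
Qed.

Lemma monomial_lipschitz (R : realFieldType) (I : finType) (x y : I -> R) (a : I -> nat) e :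
  (forall i, 0 <= x i <= 1) -> (forall i, 0 <= y i <= 1) ->
  (forall i, `|x i - y i| <= e) ->
  `|\prod_i x i ^+ a i - \prod_i y i ^+ a i| <= (\sum_i a i)%N%:R * e.
Proof.
move=> x01 y01 xye.
have n1 (z : I -> R) i k : (forall i, 0 <= z i <= 1) -> `|z i ^+ k| <= 1.
  move=> z01; have /andP[z0 z1] := z01 i.
  by rewrite normrX exprn_ile1// ger0_norm.
apply: le_trans (_ : _ <= \sum_i `|x i ^+ a i - y i ^+ a i|) _.
  by apply: ler_norm_prodB => i; exact: n1.
rewrite natr_sum mulr_suml; apply: ler_sum => i _.
rewrite -(card_ord (a i)) -!prodr_const.
apply: le_trans (_ : _ <= \sum_(j < a i) `|x i - y i|) _.
  by apply: ler_norm_prodB => j; rewrite -[X in `|X|]expr1; exact: n1.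
by rewrite sumr_const card_ord -[leLHS]mulr_natl ler_wpM2l.
Qed.

Section WeakLimit.
Variables (R : realType) (p : nat).
Local Notation q := p.+1.
Variables (J : nat -> finType) (x : forall N, J N -> 'I_q -> R).
Variables (wt : forall N, J N -> R) (M : R).
Hypothesis x01 : forall N k i, 0 <= x (N := N) k i <= 1.
Hypothesis wt0 : forall N k, 0 <= wt (N := N) k.
Hypothesis wtM : forall N, \sum_k wt (N := N) k = M.

(** Mass that the N-th discrete measure gives to the box of w, a point being assigned to boxes by
    its greedy digits. *)
Let mN N (w : seq bool) : R :=
  \sum_(k | word (digit (x (N := N) k)) (size w) == w) wt k.

Let mND N w : mN N w = mN N (false :: w) + mN N (true :: w).
Proof.
rewrite /mN (bigID (fun k => digit (x k) w)) /= addrC.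
congr (_ + _); apply: eq_bigl => k; rewrite eqseq_cons;
  by case: (eqVneq (word _ _) w) => [->|_]; rewrite ?andbF ?andbT //; case: (digit _ _).
Qed.

Let mN_itv N w : 0 <= mN N w <= M.
Proof.
rewrite /mN sumr_ge0//= -(wtM N) [leRHS](bigID (fun k => word (digit (x k)) (size w) == w))/=.
by rewrite lerDl sumr_ge0.
Qed.

Let tsumN N (f : seq bool -> R) l w : tsum (mN N) f l w =
  \sum_(k | word (digit (x (N := N) k)) (size w) == w)
     wt k * f (word (digit (x k)) (l + size w)).
Proof.
elim: l w => [|l IH] w /=.
  by rewrite /mN mulr_sumr; apply: eq_bigr => k /eqP ->; rewrite mulrC.
rewrite !IH [RHS](bigID (fun k => digit (x k) w)) /= addrC !addnS.
congr (_ + _); apply: eq_bigl => k; rewrite eqseq_cons;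
  by case: (eqVneq (word _ _) w) => [->|_]; rewrite ?andbF ?andbT //; case: (digit _ _).
Qed.

(** For fixed depth, a step function on boxes has integrals that converge by finite additivity, and
    a monomial is uniformly close to its values at lower corners. Both the discrete points and [X t]
    are only known to lie in the closed box of their word, which is enough. *)
Theorem weak_limit_on_cube :
  exists (P : {measure set (measurableTypeR R) -> \bar R})
         (X : measurableTypeR R -> 'I_q -> R),
    [/\ P setT = M%:E,
        forall i, measurable_fun setT (X ^~ i),
        forall t i, 0 <= X t i <= 1 &
        forall (a : 'I_q -> nat) (G : R),
          (\sum_k wt (N := N) k * \prod_i x k i ^+ a i) @[N --> \oo] --> G ->
          \int[P]_t (\prod_i X t i ^+ a i) = G].
Proof.
have [U [UU oU]] := ultraFilterLemma (F := \oo) _.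
have UF : ProperFilter U by exact: ultra_proper.
have mex w : exists l, 0 <= l <= M /\ mN N w @[N --> U] --> l.
  by have [l ? ?] := ultra_cvg UU (fun N => mN_itv N w); exists l.
have [m mP] := choice mex.
have m0 w : 0 <= m w by have [/andP[]] := mP w.
have mcvg w : mN N w @[N --> U] --> m w by have [] := mP w.
have mD w : m w = m (false :: w) + m (true :: w).
  apply: (norm_cvg_unique (mcvg w)).
  rewrite (_ : (fun N => mN N w) =
      (fun N => mN N (false :: w) + mN N (true :: w))); last first.
    by apply/funext => N; rewrite mND.
  by apply: cvgD.
have mM : m [::] = M.
  apply: (norm_cvg_unique (mcvg [::])).
  rewrite (_ : (fun N => mN N [::]) = (fun=> M)); first exact: cvg_cst.
  by apply/funext => N; rewrite -(wtM N) /mN; apply: eq_bigl => k.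
have M0 : 0 <= M by rewrite -mM.
have tcvg f l w : tsum (mN N) f l w @[N --> U] --> tsum m f l w.
  elim: l w => [|l IH] w /=; first by apply: cvgM => //; exact: cvg_cst.
  by apply: cvgD.
pose X (t : measurableTypeR R) i := @word_limit R p (branch m t) i.
have X01 t i : 0 <= X t i <= 1 by exact: word_limit_itv.
have mX i : measurable_fun setT (X ^~ i).
  pose g h (t : measurableTypeR R) := @corner R p (word (branch m t) (h * q)) i.
  apply: (@measurable_fun_cvg _ _ _ setT g (X ^~ i)) => [h|t _].
    exact: (measurable_word m (fun w => @corner R p w i)).
  exact: corner_word_cvg.
exists (treemu m), X; split => //; first by rewrite /= (treemu_setT m0 mD) mM.
move=> a G aG.
pose f w : R := \prod_i @corner R p w i ^+ a i.
have corner01 w i : 0 <= @corner R p w i <= 1.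
  by rewrite corner_ge0 (le_trans _ (upper_corner_le1 R w i))// lerDl width_ge0.
have prod1 (z : 'I_q -> R) : (forall i, 0 <= z i <= 1) -> `|\prod_i z i ^+ a i| <= 1.
  move=> z01; have z0 i : 0 <= z i ^+ a i <= 1.
    by have /andP[? ?] := z01 i; rewrite exprn_ge0//= exprn_ile1.
  have /andP[? ?] : 0 <= \prod_i z i ^+ a i <= 1.
    elim/big_ind: _ => // [|u v /andP[u0 u1] /andP[v0 v1]]; first by rewrite ler01 lexx.
    by rewrite mulr_ge0//= mulr_ile1.
  by rewrite ger0_norm.
pose D : R := (\sum_i a i)%N%:R.
(* Lipschitz constant of the monomial in the sup norm, times the side of a box after h rounds, times
   the total mass. *)
pose e h : R := D * (2^-1) ^+ h * M.
have e_cvg : e h @[h --> \oo] --> (0 : R).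
  suff : e h @[h --> \oo] --> D * 0 * M by rewrite mulr0 mul0r.
  apply: cvgM; last exact: cvg_cst.
  apply: cvgM; first exact: cvg_cst.
  by apply: cvg_expr; rewrite ger0_norm ?invr_ge0// invf_lt1// ltr1n.
have est1 h N : `|\sum_k wt (N := N) k * \prod_i x k i ^+ a i
    - tsum (mN N) f (h * q) [::]| <= e h.
  rewrite tsumN addn0 -sumrB; apply: le_trans (ler_norm_sum _ _ _) _.
  rewrite /e -(wtM N) mulr_sumr; apply: ler_sum => k _.
  rewrite -mulrBr normrM ger0_norm// mulrC; apply: ler_wpM2r => //.
  apply: monomial_lipschitz => // i.
  have := digit_bounds (x01 k) (h * q) i; rewrite width_round => /andP[h1 h2].
  by rewrite ger0_norm ?subr_ge0// lerBlDl.
(* N goes to the limit along the ultrafilter with h fixed; h goes to infinity only at the end. *)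
have est2 h : `|G - tsum m f (h * q) [::]| <= e h.
  have c : (\sum_k wt (N := N) k * \prod_i x k i ^+ a i
    - tsum (mN N) f (h * q) [::]) @[N --> U] --> G - tsum m f (h * q) [::].
    by apply: cvgB => //; exact: cvg_trans (cvg_app _ oU) aG.
  by apply: (cvgr_to_le (cvg_norm c)); near=> N; exact: est1.
have mprod : measurable_fun setT (fun t => \prod_i X t i ^+ a i).
  apply: measurable_prod => i _; exact: measurable_funX.
have mf h : measurable_fun setT (fun t : measurableTypeR R => f (word (branch m t) (h * q))).
  exact: measurable_word.
have iX : (treemu m).-integrable setT (EFin \o (fun t => \prod_i X t i ^+ a i)).
  by apply: (@integrable_bounded _ _ m0 mD _ (1)) => // t; exact: prod1.
have If h : (treemu m).-integrable setT
    (EFin \o (fun t : measurableTypeR R => f (word (branch m t) (h * q)))).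
  by apply: (@integrable_bounded _ _ m0 mD _ (1)) => // t; exact: prod1.
have est3 h : `|\int[treemu m]_t (\prod_i X t i ^+ a i) - tsum m f (h * q) [::]| <= e h.
  have f1 w : `|f w| <= 1 by exact: prod1.
  rewrite -(@Rintegral_word _ _ m0 mD f 1 (h * q) [::])// addn0.
  rewrite -(@Rintegral_treemu _ _ m0 mD _ 1)//.
  pose g t := \prod_i X t i ^+ a i - f (word (branch m t) (h * q)).
  have mg : measurable_fun setT g by exact: measurable_funB.
  have g2 t : `|g t| <= 2.
    rewrite (_ : 2 = 1 + 1)//; apply: le_trans (ler_normB _ _) _.
    by apply: lerD; [exact: prod1|exact: f1].
  have ig : (treemu m).-integrable setT (EFin \o g).
    exact: (@integrable_bounded _ _ m0 mD _ 2).
  rewrite -RintegralB//; apply: le_trans (le_normr_Rintegral _ ig) _ => //.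
  apply: le_trans (_ : _ <= \int[treemu m]_t (D * (2^-1) ^+ h)) _; last first.
    by rewrite Rintegral_cst//= (treemu_setT m0 mD) mM.
  apply: le_Rintegral => //.
  - exact: (integrable_norm ig).
  - apply: (@integrable_bounded _ _ m0 mD _ (`|D * (2^-1) ^+ h|)) => //.
  - move=> t _; apply: monomial_lipschitz => // i.
    have := @corner_word_limit R p (branch m t) (h * q) i.
    rewrite width_round => /andP[h1 h2].
    by rewrite ger0_norm ?subr_ge0// lerBlDl.
apply/eqP; rewrite -subr_eq0 -normr_le0.
have e2 : (e h + e h) @[h --> \oo] --> (0 : R).
  by rewrite -[X in _ --> X](addr0 0); apply: cvgD.
apply: (cvgr_to_ge e2); near=> h.
have -> : \int[treemu m]_t (\prod_i X t i ^+ a i) - G =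
  (\int[treemu m]_t (\prod_i X t i ^+ a i) - tsum m f (h * q) [::])
   - (G - tsum m f (h * q) [::]) by ring.
apply: le_trans (ler_normB _ _) _; apply: lerD; [exact: est3|exact: est2].
Unshelve. all: by end_near. Qed.

End WeakLimit.

Theorem hausdorff_moment (R : realType) (q : nat) (A : comNzRingType)
    (t : 'I_q -> A) (lam : A -> R) : (0 < q)%N ->
  (forall f g, lam (f + g) = lam f + lam g) ->
  (forall N (k : {ffun 'I_q -> 'I_N.+1}), 0 <= lam (bern t k)) ->
  exists (P : {measure set (measurableTypeR R) -> \bar R})
         (X : measurableTypeR R -> 'I_q -> R),
    [/\ P setT = (lam 1)%:E,
        forall i, measurable_fun setT (X ^~ i),
        forall s i, 0 <= X s i <= 1 &
        forall a : 'I_q -> nat,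
          \int[P]_s (\prod_i X s i ^+ a i) = lam (\prod_i t i ^+ a i)].
Proof.
case: q t => // p t _ lamD lam0.
(* Degree N + 1 keeps the grid points k / (N + 1) meaningful for every N. *)
have [|||P [X [PM mX X01 PX]]] := @weak_limit_on_cube R p
    (fun N => {ffun 'I_p.+1 -> 'I_N.+2})
    (fun N k i => (k i)%:R / N.+1%:R) (fun N k => lam (bern t k)) (lam 1).
- move=> N k i; rewrite divr_ge0//= ler_pdivrMr ?ltr0n// mul1r ler_nat.
  by rewrite -ltnS.
- by move=> N k; exact: lam0.
- by move=> N; exact: bern_mass.
exists P, X; split => // a; apply: PX.
pose K : R := lam 1 * (\sum_i a i ^ 2)%N%:R.
have cK : (K * N.+1%:R^-1) @[N --> \oo] --> (0 : R).
  rewrite -[X in _ --> X](mulr0 K); apply: cvgM; first exact: cvg_cst.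
  exact: cvg_harmonic.
apply/cvgrPdist_le => e e0; near=> N.
apply: le_trans (_ : _ <= K * N.+1%:R^-1) _.
  rewrite distrC; apply: bern_moment => // i.
  apply: leq_trans (_ : \sum_i a i <= _)%N.
    by rewrite (bigD1 i)//= leq_addr.
  by apply: leq_trans (leqnSn _); near: N; exact: nbhs_infty_ge.
by near: N; exact: cvgr_le cK _ e0.
Unshelve. all: by end_near. Qed.

(** * Integrals of complex-valued functions *)

Section ComplexIntegral.
Context d (T : measurableType d) (R : realType) (mu : {measure set T -> \bar R}).
Implicit Types (f g : T -> R[i]) (c : R[i]).

Definition cintegrable f :=
  mu.-integrable setT (fun x => (complex.Re (f x))%:E) /\
  mu.-integrable setT (fun x => (complex.Im (f x))%:E).

Definition cint f : R[i] :=
  Complex (\int[mu]_x complex.Re (f x)) (\int[mu]_x complex.Im (f x)).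

Lemma eq_cintegrable f g : f =1 g -> cintegrable f -> cintegrable g.
Proof. by move=> /funext ->. Qed.

Lemma eq_cint f g : f =1 g -> cint f = cint g.
Proof. by move=> /funext ->. Qed.

Lemma cintegrableD f g : cintegrable f -> cintegrable g ->
  cintegrable (fun x => f x + g x).
Proof.
move=> [f1 f2] [g1 g2]; split.
- rewrite (_ : (fun x => _) = (fun x => (complex.Re (f x))%:E + (complex.Re (g x))%:E)%E).
    exact: integrableD.
  by apply/funext => x; rewrite raddfD EFinD.
- rewrite (_ : (fun x => _) = (fun x => (complex.Im (f x))%:E + (complex.Im (g x))%:E)%E).
    exact: integrableD.
  by apply/funext => x; rewrite raddfD EFinD.
Qed.

Lemma cintD f g : cintegrable f -> cintegrable g ->
  cint (fun x => f x + g x) = cint f + cint g.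
Proof.
move=> [f1 f2] [g1 g2]; rewrite /cint.
have -> : (fun x => complex.Re (f x + g x)) = (fun x => complex.Re (f x) + complex.Re (g x)).
  by apply/funext => x; rewrite raddfD.
have -> : (fun x => complex.Im (f x + g x)) = (fun x => complex.Im (f x) + complex.Im (g x)).
  by apply/funext => x; rewrite raddfD.
by rewrite !RintegralD.
Qed.

Let ReM c z : complex.Re (c * z) = complex.Re c * complex.Re z - complex.Im c * complex.Im z.
Proof. by case: c z => [a b] [a' b']. Qed.

Let ImM c z : complex.Im (c * z) = complex.Re c * complex.Im z + complex.Im c * complex.Re z.
Proof. by case: c z => [a b] [a' b'] /=; rewrite (mulrC b). Qed.

Let integrableMl (r : R) (f : T -> R) : mu.-integrable setT (fun x => (f x)%:E) ->
  mu.-integrable setT (fun x => (r * f x)%:E).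
Proof. by move=> h; under eq_fun do rewrite EFinM; exact: integrableZl. Qed.

Lemma cintegrableZ c f : cintegrable f -> cintegrable (fun x => c * f x).
Proof.
move=> [f1 f2]; split.
- rewrite (_ : (fun x => _) = (fun x => (complex.Re c * complex.Re (f x))%:E -
      (complex.Im c * complex.Im (f x))%:E)%E).
    by apply: integrableB => //; exact: integrableMl.
  by apply/funext => x; rewrite ReM EFinB.
- rewrite (_ : (fun x => _) = (fun x => (complex.Re c * complex.Im (f x))%:E +
      (complex.Im c * complex.Re (f x))%:E)%E).
    by apply: integrableD => //; exact: integrableMl.
  by apply/funext => x; rewrite ImM EFinD.
Qed.

Lemma cintZ c f : cintegrable f -> cint (fun x => c * f x) = c * cint f.
Proof.
move=> [f1 f2]; rewrite /cint.
have -> : (fun x => complex.Re (c * f x)) =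
   (fun x => complex.Re c * complex.Re (f x) - complex.Im c * complex.Im (f x)).
  by apply/funext => x; rewrite ReM.
have -> : (fun x => complex.Im (c * f x)) =
   (fun x => complex.Re c * complex.Im (f x) + complex.Im c * complex.Re (f x)).
  by apply/funext => x; rewrite ImM.
rewrite RintegralB ?RintegralD//; try exact: integrableMl.
rewrite !RintegralZl//.
by case: c => a b; congr Complex; rewrite /=; congr (_ + _); rewrite mulrC.
Qed.

Lemma cintegrable_cst0 : cintegrable (fun=> 0).
Proof. by split; exact: integrable0. Qed.

Lemma cint_cst0 : cint (fun=> 0) = 0.
Proof. by rewrite /cint !Rintegral_cst// !mul0r. Qed.

(** The null set will be the complement of K: integrals run over the whole space, while positivity
    is known on K only. *)
Lemma cint_ge0 (N : set T) f : measurable N -> mu N = 0%E -> cintegrable f ->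
  (forall x, ~ N x -> 0 <= f x) -> 0 <= cint f.
Proof.
move=> mN N0 [f1 f2] f0.
have re x : ~ N x -> 0 <= complex.Re (f x) /\ complex.Im (f x) = 0.
  by move=> /f0; rewrite lecE => /andP[/eqP h ?]; split => //; rewrite h.
rewrite lecE /=; apply/andP; split.
  rewrite /Rintegral (negligible_integral mN)//; apply/eqP.
  rewrite (_ : (\int[mu]_(x in _) _)%E = (\int[mu]_(x in setT `\` N) 0)%E).
    by rewrite integral0.
  by apply: eq_integral => x /set_mem [_ /re[_ ->]].
rewrite /Rintegral (negligible_integral mN)// fine_ge0//.
by apply: integral_ge0 => x [_ /re[h _]]; rewrite lee_fin.
Qed.

End ComplexIntegral.

(** * Support of the measure *)

Section Support.
Context d (T : measurableType d) (R : realType) (P : {measure set T -> \bar R}).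

(** Since K + k x dominates k x, this bounds x (K - x)^k by K^(k+1) / k. *)
Let bernoulli (K x : R) k : 0 <= x <= K -> (K - x) ^+ k * (K + k%:R * x) <= K ^+ k.+1.
Proof.
move=> /andP[x0 xK]; elim: k => [|k IH]; first by rewrite mul0r addr0 expr1 mul1r.
rewrite exprSr -mulrA [leRHS]exprS.
apply: (@le_trans _ _ ((K - x) ^+ k * (K * (K + k%:R * x)))).
  apply: ler_wpM2l; first by rewrite exprn_ge0// subr_ge0.
  rewrite -natr1; have : 0 <= (k%:R + 1) * x ^+ 2 by rewrite mulr_ge0// ?sqr_ge0// addr_ge0.
  by rewrite expr2; set u := k%:R; nra.
by rewrite mulrCA; apply: ler_wpM2l => //; apply: le_trans xK.
Qed.

(** Relative to K^(k+1), damping makes the positive part at most K / (k+1), whereas for s < 0 the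
    factor (K - s)^(k+1) is at least K^(k+1). If the left side has nonnegative integral for all k,
    the negative part must integrate to 0. *)
Lemma damped_le (K s : R) k : 0 < K -> s <= K ->
  s * (K - s) ^+ k.+1 <= K ^+ k.+1 * (K / k.+1%:R - Num.max (- s) 0).
Proof.
move=> K0 sK; have k0 : 0 < k.+1%:R :> R by rewrite ltr0n.
case: (leP 0 s) => s0.
  rewrite max_r ?oppr_le0// subr0 mulrA -exprSr ler_pdivlMr//.
  apply: le_trans (@bernoulli K s k.+1 _); last by apply/andP; split.
  rewrite mulrC mulrA mulrC; apply: ler_wpM2l; first by rewrite exprn_ge0// subr_ge0.
  by rewrite lerDr ltW.
rewrite max_l; last by rewrite oppr_ge0 ltW.
rewrite opprK; apply: (@le_trans _ _ (K ^+ k.+1 * s)).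
  rewrite mulrC; apply: ler_wnM2r; first exact: ltW.
  apply: lerXn2r; rewrite ?nnegrE ?ltW//; first by rewrite subr_gt0 (lt_trans s0).
  by rewrite ltrDl oppr_gt0.
by apply: ler_wpM2l; [rewrite exprn_ge0// ltW|rewrite lerDr divr_ge0// ltW].
Qed.

Lemma support_ge0 (f : T -> R) (K : R) : (P setT < +oo)%E -> 0 < K ->
  (forall x, f x <= K) ->
  (forall k, P.-integrable setT (fun x => (f x * (K - f x) ^+ k)%:E)) ->
  (forall k, 0 <= \int[P]_x (f x * (K - f x) ^+ k)) ->
  P [set x | f x < 0] = 0%E.
Proof.
move=> Pfin K0 fK fi f0.
have fif : P.-integrable setT (EFin \o f).
  by have := fi 0%N; under eq_fun do rewrite expr0 mulr1.
have mf : measurable_fun setT f by apply/measurable_EFinP; exact: measurable_int fif.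
pose g x := Num.max (- f x) 0.
have g0 x : 0 <= g x by rewrite le_max lexx orbT.
have mg : measurable_fun setT g.
  by apply: measurable_maxr => //; exact: measurableT_comp.
have gi : P.-integrable setT (EFin \o g).
  apply: le_integrable fif => //; first exact/measurable_EFinP.
  move=> x _ /=; rewrite lee_fin /g; case: (leP (- f x) 0) => h.
    by rewrite normr0.
  by rewrite normrN.
have ci (c : R) : P.-integrable setT (EFin \o cst c).
  apply: measurable_bounded_integrable => //.
  exists `|c|; split; first exact: num_real.
  by move=> x cx t _ /=; exact: ltW.
pose M := fine (P setT).
have M0 : 0 <= M by rewrite fine_ge0.
have bd k : \int[P]_x g x <= K * M / k.+1%:R.
  have h : 0 <= \int[P]_x (K ^+ k.+1 * (K / k.+1%:R - g x)).
    apply: (le_trans (f0 k.+1)); apply: le_Rintegral => //.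
    - exact: fi k.+1.
    - rewrite (_ : _ \o _ =
         (fun x => (K ^+ k.+1)%:E * ((K / k.+1%:R)%:E - (g x)%:E))%E); last first.
        by apply/funext => x; rewrite /= EFinM EFinB.
      apply: integrableZl => //; apply: integrableB => //; exact: ci.
    - by move=> x _; exact: damped_le.
  move: h; rewrite RintegralZl//; last first.
    rewrite (_ : _ \o _ = (fun x => (K / k.+1%:R)%:E - (g x)%:E)%E); last first.
      by apply/funext => x; rewrite /= EFinB.
    by apply: integrableB => //; exact: ci.
  rewrite pmulr_rge0 ?exprn_gt0// RintegralB//; last exact: ci.
  by rewrite Rintegral_cst// subr_ge0 mulrAC.
have g00 : \int[P]_x g x = 0.
  apply/eqP; rewrite eq_le Rintegral_ge0// andbT.
  have c : (K * M * k.+1%:R^-1) @[k --> \oo] --> (0 : R).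
    rewrite -[X in _ --> X](mulr0 (K * M)); apply: cvgM; first exact: cvg_cst.
    exact: cvg_harmonic.
  by apply: (cvgr_to_ge c); near=> k; exact: bd.
have : (\int[P]_x `|(g x)%:E| = 0)%E.
  under eq_integral do rewrite gee0_abs ?lee_fin//.
  by rewrite -[LHS]fineK ?integrable_fin_num// -/(Rintegral _ _ _) g00.
move/(ae_eq_integral_abs P measurableT (iffRL (measurable_EFinP _ _) mg)) => [N [mN N0 sN]].
have mS : measurable [set x | f x < 0].
  rewrite (_ : [set x | _] = f @^-1` `]-oo, 0[).
    by rewrite -[X in measurable X]setTI; exact: mf.
  by apply/seteqP; split => x /=; rewrite in_itv.
apply/eqP; rewrite eq_le measure_ge0 andbT -N0; apply: le_measure; rewrite ?inE//.
move=> x /= fx; apply: sN => /= h; have := h I.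
move=> -[]; rewrite /g max_l; last by rewrite oppr_ge0 ltW.
by move/eqP; rewrite oppr_eq0 lt_eqF.
Unshelve. all: by end_near. Qed.

End Support.

(** * Representation *)

Section Representation.
Variables (R : realType) (n : nat).
Local Notation C :=
  (complex_complex__canonical__Num_ClosedField (reals_Real__to__Num_RealClosedField R)).
Local Notation B := (mpoly (n + n) C).

(** Inverse of the coordinates [cubeX], sending the unit cube to [-r, r]^(2n). *)
Definition cubemap (r : R) (x : 'I_(n + n) -> R) : Cn R n :=
  [tuple (r * (2 * x (lshift n j) - 1), r * (2 * x (rshift n j) - 1)) | j < n].

Let conjE (a b : R) : (Complex a b : C)^* = Complex a (- b).
Proof. by []. Qed.

Lemma ev_cubeX (r : R) x i : 0 < r ->
  ev (coord (cubemap r x)) (cubeX (Complex r 0 : C) i) = Complex (x i) 0.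
Proof.
move=> r0; have r40 : ((Complex r 0 : C) *+ 4) != 0.
  by rewrite mulrn_eq0 /= eq_complex /= gt_eqF.
rewrite -(splitK i); case: (fintype.split i) => j.
  rewrite [unsplit _]/= cubeX_l evZ; apply: (mulfI r40); rewrite mulrA divff// mul1r.
  rewrite /affine_form !evD !evM !evC ev_holX ev_antX /coord tnth_mktuple conjC1 conjE.
  apply/eqP; rewrite eq_complex /=; apply/andP; split; apply/eqP; ring.
rewrite [unsplit _]/= cubeX_r evZ; apply: (mulfI r40); rewrite mulrA divff// mul1r.
rewrite /affine_form !evD !evM !evC ev_holX ev_antX /coord tnth_mktuple.
rewrite (rmorphN Num.conj) /= conjCi opprK conjE.
have -> : ('i : C) = Complex 0 1 by [].
apply/eqP; rewrite eq_complex /=; apply/andP; split; apply/eqP; ring.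
Qed.

(** Boundedness of polynomials along F is part of the conclusion because F ranges over the cube, not
    the sphere, and the support argument needs a pointwise bound there. *)
Theorem moment_representation (L : B -> C) (r : R) : (0 < n)%N -> 0 < r ->
  (forall p q, L (p + q) = L p + L q) -> (forall c p, L (c *: p) = c * L p) ->
  (forall q, sos (Complex r 0 : C) q -> 0 <= L q) ->
  exists (P : {measure set (measurableTypeR R) -> \bar R})
         (F : measurableTypeR R -> Cn R n),
    [/\ (P setT < +oo)%E, measurable_fun setT F,
        forall q, exists K : C, forall t, `|ev (coord (F t)) q| <= K &
        forall q, cintegrable P (fun t => ev (coord (F t)) q) /\
                  L q = cint P (fun t => ev (coord (F t)) q)].
Proof.
move=> n0 r0 LD LZ Lsos.
have r0C : 0 < (Complex r 0 : C) by rewrite ltcE /= eqxx.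
pose rC : C := Complex r 0.
have [|||P [X [PT mX X01 PX]]] := @hausdorff_moment R (n + n) B (cubeX rC)
  (fun q => complex.Re (L q)).
- by rewrite addn_gt0 n0.
- by move=> f g /=; rewrite LD; case: (L f) (L g) => [? ?] [? ?].
- by move=> N k; have := Lsos _ (sos_bern r0C k); rewrite lecE => /andP[].
pose F t := cubemap r (X t).
have Pfin : (P setT < +oo)%E by rewrite PT ltry.
have evT t i : ev (coord (F t)) (cubeX rC i) = Complex (X t i) 0 by exact: ev_cubeX.
exists P, F; split => //.
- apply/measurable_fun_tnthP => j; apply/measurable_fun_pairP; split.
  + rewrite (_ : _ \o _ = fun t => r * (2 * X t (lshift n j) - 1)); last first.
      by apply/funext => t /=; rewrite tnth_mktuple.
    apply: measurable_funM => //; apply: measurable_funB => //.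
    exact: measurable_funM.
  + rewrite (_ : _ \o _ = fun t => r * (2 * X t (rshift n j) - 1)); last first.
      by apply/funext => t /=; rewrite tnth_mktuple.
    apply: measurable_funM => //; apply: measurable_funB => //.
    exact: measurable_funM.
- apply: (cubeX_ind r0C) => [|p q [K Kp] [K' Kq]|c p [K Kp]|i p [K Kp]].
  + by exists 1 => t; rewrite -(rmorph1 (mpolyC (n + n) (R := C))) evC normr1.
  + by exists (K + K') => t; rewrite evD; apply: le_trans (ler_normD _ _) _; exact: lerD.
  + by exists (`|c| * K) => t; rewrite evZ normrM ler_wpM2l.
  + exists K => t; rewrite evM normrM evT; apply: le_trans (Kp t).
    apply: ler_piMl => //; have /andP[x0 x1] := X01 t i.
    by rewrite ger0_norm lecE /= eqxx.
pose good q := cintegrable P (fun t => ev (coord (F t)) q) /\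
                  L q = cint P (fun t => ev (coord (F t)) q).
(* A free monomial factor lets the induction absorb each [cubeX i] into the exponents. *)
suff H q : forall a : 'I_(n + n) -> nat, good (q * \prod_i cubeX rC i ^+ a i).
  have e : \prod_i cubeX rC i ^+ 0 = 1 :> B by rewrite big1// => i _; rewrite expr0.
  by move=> q; have := H q (fun=> 0%N); rewrite e mulr1.
elim/(@cubeX_ind C n _ r0C): q => [a|p q Hp Hq a|c p Hp a|i p Hp a].
- rewrite mul1r.
  have evE t : ev (coord (F t)) (\prod_i cubeX rC i ^+ a i) =
      Complex (\prod_i X t i ^+ a i) 0.
    rewrite ev_prod (eq_bigr (fun i => (Complex (X t i ^+ a i) 0 : C))).
      by rewrite -(rmorph_prod (@real_complex R)).
    by move=> i _; rewrite evX evT -(rmorphXn (@real_complex R)).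
  have int : P.-integrable setT (EFin \o (fun t => \prod_i X t i ^+ a i)).
    apply: measurable_bounded_integrable => //.
      apply: measurable_prod => i _; exact: measurable_funX.
    exists 1; split; first exact: num_real.
    move=> z z1 t _ /=; apply: le_trans (ltW z1).
    have /andP[? ?] : 0 <= \prod_i X t i ^+ a i <= 1.
      elim/big_ind: _ => [|u v /andP[u0 u1] /andP[v0 v1]|i _].
      - by rewrite ler01 lexx.
      - by rewrite mulr_ge0//= mulr_ile1.
      - by have /andP[? ?] := X01 t i; rewrite exprn_ge0//= exprn_ile1.
    by rewrite ger0_norm.
  split.
    apply: (eq_cintegrable (f := fun t => Complex (\prod_i X t i ^+ a i) 0)).
      by move=> t; rewrite evE.
    by split => //=; exact: integrable0.
  rewrite (eq_cint _ evE) /cint /= Rintegral_cst// mul0r PX.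
  (* Only Re L was represented; on these monomials L is real because they lie in the cone. *)
  have : sos rC (\prod_i cubeX rC i ^+ a i).
    by apply: sos_prod => i _; exact/sosX/sos_cubeX.
  by move/Lsos; rewrite lecE => /andP[/eqP]; case: (L _) => u v /= ->.
- have [Ip Lp] := Hp a; have [Iq Lq] := Hq a; rewrite mulrDl; split.
    apply: eq_cintegrable (cintegrableD Ip Iq) => t; by rewrite evD.
  rewrite LD Lp Lq -(cintD Ip Iq); apply: eq_cint => t; by rewrite evD.
- have [Ip Lp] := Hp a; rewrite -scalerAl; split.
    apply: eq_cintegrable (cintegrableZ c Ip) => t; by rewrite evZ.
  rewrite LZ Lp -(cintZ c Ip); apply: eq_cint => t; by rewrite evZ.
- have -> : cubeX rC i * p * \prod_j cubeX rC j ^+ a j =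
      p * \prod_j cubeX rC j ^+ (if j == i then (a j).+1 else a j).
    rewrite -mulrA mulrCA; congr (_ * _).
    rewrite [in LHS](bigD1 i)//= [in RHS](bigD1 i)//= eqxx mulrA -exprS.
    by congr (_ * _); apply: eq_bigr => j /negbTE ->.
  exact: Hp.
Qed.

End Representation.

Local Notation Cpx R :=
  (complex_complex__canonical__Num_ClosedField (reals_Real__to__Num_RealClosedField R)).

(** * Moment matrices as functionals, and measurability of K *)

Section Bridge.
Variables (R : realType) (n : nat).
Local Notation C := (Cpx R).
Local Notation B := (mpoly (n + n) C).
Implicit Types (c y : mi n -> mi n -> C).

Lemma ev_coord_mono (z : Cn R n) a b :
  ev (coord z) (mono C a b) = zbarmon z a * zmon z b.
Proof. exact: ev_mono. Qed.

Lemma ev_gpoly (z : Cn R n) k c : ev (coord z) (gpoly k c) = peval k c z.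
Proof.
rewrite /gpoly /peval ev_sum; apply: eq_bigr => g _.
by rewrite ev_sum; apply: eq_bigr => h _; rewrite evZ ev_mono mulrA.
Qed.

Lemma peval_real (z : Cn R n) k c : (forall a b, (c a b)^* = c b a) ->
  (peval k c z)^* = peval k c z.
Proof.
by move=> ch; rewrite -ev_gpoly; apply: conj_ev_gpoly.
Qed.

Lemma cint_riesz d (T : measurableType d) (P : {measure set T -> \bar R})
    (F : T -> Cn R n) y :
  (forall a b, cintegrable P (fun t => ev (coord (F t)) (mono C a b)) /\
     y a b = cint P (fun t => ev (coord (F t)) (mono C a b))) ->
  forall q, cintegrable P (fun t => ev (coord (F t)) q) /\
            riesz y q = cint P (fun t => ev (coord (F t)) q).
Proof.
move=> H; elim/mono_ind => [|c a b q [Iq Lq]].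
  split; first by apply: eq_cintegrable (cintegrable_cst0 P) => t; rewrite ev0.
  rewrite -[0](scale0r 1) rieszZ mul0r -[LHS](cint_cst0 P); apply: eq_cint => t.
  by rewrite evZ mul0r.
have [Ia La] := H a b; have Ica := cintegrableZ c Ia.
split.
  by apply: eq_cintegrable (cintegrableD Ica Iq) => t; rewrite evD evZ.
rewrite rieszD rieszZ riesz_mono La Lq -(cintZ c Ia) -(cintD Ica Iq).
by apply: eq_cint => t; rewrite evD evZ.
Qed.

Lemma mom_psdP k c y : (forall d, mom_psd d (mom_entry k c y)) <->
  (forall P, 0 <= riesz y (antP P * holP P * gpoly k c)).
Proof.
split=> [h|h d v].
  by apply: riesz_ge0 => d v; exact: h d v.
by have := h (vpoly v); rewrite -mom_form.
Qed.

Definition cmeasurable (q : B) :=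
  measurable_fun setT (fun z : Cn R n => complex.Re (ev (coord z) q)) /\
  measurable_fun setT (fun z : Cn R n => complex.Im (ev (coord z) q)).

Let cmeasurableC (c : C) : cmeasurable (mpolyC (n + n) c).
Proof.
split.
- rewrite (_ : (fun z => _) = cst (complex.Re c)); first exact: measurable_cst.
  by apply/funext => z; rewrite evC.
- rewrite (_ : (fun z => _) = cst (complex.Im c)); first exact: measurable_cst.
  by apply/funext => z; rewrite evC.
Qed.

Let cmeasurableD p q : cmeasurable p -> cmeasurable q -> cmeasurable (p + q).
Proof.
move=> [p1 p2] [q1 q2]; split.
- rewrite (_ : (fun z => _) =
      (fun z => complex.Re (ev (coord z) p) + complex.Re (ev (coord z) q))).
    exact: measurable_funD.
  by apply/funext => z; rewrite evD; case: (ev _ p) (ev _ q) => [? ?] [? ?].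
- rewrite (_ : (fun z => _) =
      (fun z => complex.Im (ev (coord z) p) + complex.Im (ev (coord z) q))).
    exact: measurable_funD.
  by apply/funext => z; rewrite evD; case: (ev _ p) (ev _ q) => [? ?] [? ?].
Qed.

Let cmeasurableM p q : cmeasurable p -> cmeasurable q -> cmeasurable (p * q).
Proof.
move=> [p1 p2] [q1 q2]; split.
- rewrite (_ : (fun z => _) =
      (fun z => complex.Re (ev (coord z) p) * complex.Re (ev (coord z) q)
     - complex.Im (ev (coord z) p) * complex.Im (ev (coord z) q))).
    by apply: measurable_funB; exact: measurable_funM.
  by apply/funext => z; rewrite evM; case: (ev _ p) (ev _ q) => [? ?] [? ?].
- rewrite (_ : (fun z => _) =
      (fun z => complex.Re (ev (coord z) p) * complex.Im (ev (coord z) q)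
     + complex.Im (ev (coord z) p) * complex.Re (ev (coord z) q))).
    by apply: measurable_funD; exact: measurable_funM.
  by apply/funext => z; rewrite evM; case: (ev _ p) (ev _ q) => [? ?] [? ?].
Qed.

Let cmeasurable_gen i : cmeasurable (mpolyX C (mnm1 i)).
Proof.
have m1 j : measurable_fun setT (fun z : Cn R n => (tnth z j).1).
  exact: (measurableT_comp measurable_fst (@measurable_tnth _ _ n j)).
have m2 j : measurable_fun setT (fun z : Cn R n => (tnth z j).2).
  exact: (measurableT_comp measurable_snd (@measurable_tnth _ _ n j)).
rewrite -(splitK i); case: (fintype.split i) => j; rewrite [unsplit _]/=.
  rewrite -/(holX C j); split.
    rewrite (_ : (fun z => _) = (fun z : Cn R n => (tnth z j).1))//.
    by apply/funext => z; rewrite ev_holX.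
  rewrite (_ : (fun z => _) = (fun z : Cn R n => (tnth z j).2))//.
  by apply/funext => z; rewrite ev_holX.
rewrite -/(antX C j); split.
  rewrite (_ : (fun z => _) = (fun z : Cn R n => (tnth z j).1))//.
  by apply/funext => z; rewrite ev_antX.
rewrite (_ : (fun z => _) = (fun z : Cn R n => - (tnth z j).2)).
  exact: measurableT_comp.
by apply/funext => z; rewrite ev_antX.
Qed.

Lemma measurable_ev q : cmeasurable q.
Proof.
have c1 : cmeasurable 1 by rewrite -(rmorph1 (mpolyC (n + n) (R := C))); exact: cmeasurableC.
elim/mpolyind: q => [|c m q _ _ IH].
  by rewrite -(rmorph0 (mpolyC (n + n) (R := C))); exact: cmeasurableC.
apply: cmeasurableD; last exact: IH.
rewrite -mul_mpolyC; apply: cmeasurableM; first exact: cmeasurableC.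
rewrite mpolyXE_id.
elim/big_rec: _ => [|i p _ Hp]; first exact: c1.
apply: cmeasurableM Hp; elim: (m i) => [|l IHl]; first exact: c1.
by rewrite exprS; apply: cmeasurableM IHl; exact: cmeasurable_gen.
Qed.

(** In the order of [R[i]], being nonnegative includes having imaginary part 0, hence the two
    preimages for each constraint. *)
Lemma measurable_Kset m (k : 'I_m -> nat) (gc : 'I_m -> mi n -> mi n -> R[i]) :
  measurable (Kset k gc).
Proof.
rewrite (_ : Kset k gc = \bigcap_(i in [set: 'I_m])
    ((fun z : Cn R n => complex.Im (ev (coord z) (gpoly (k i) (gc i)))) @^-1` [set 0] `&`
     (fun z : Cn R n => complex.Re (ev (coord z) (gpoly (k i) (gc i)))) @^-1` `[0, +oo[)).
  apply: fin_bigcap_measurable => // i _.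
  have [mr mi] := measurable_ev (gpoly (k i) (gc i)).
  apply: measurableI.
  - by rewrite -[X in measurable X]setTI; exact: mi.
  - by rewrite -[X in measurable X]setTI; exact: mr.
apply/seteqP; split => z.
  move=> Kz i _ /=; rewrite in_itv /= andbT ev_gpoly.
  by have := Kz i; rewrite lecE => /andP[/eqP].
move=> Kz i; have [] := Kz i I; rewrite /= in_itv /= andbT ev_gpoly => h1 h2.
by rewrite lecE h1 eqxx.
Qed.

End Bridge.

Theorem mainTheorem9 (R : realType) (n m : nat) (k : 'I_m -> nat)
  (gc : 'I_m -> mi n -> mi n -> R[i]) (rad : R) (y : mi n -> mi n -> R[i]) :
  (0 < n)%N -> (0 < m)%N ->
  (* real-valuedness: conj(g_{i,gamma,delta}) = g_{i,delta,gamma} *)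
  (forall i a b, (gc i a b)^* = gc i b a) ->
  (* g_i has degree bound k_i: coefficients vanish unless |gamma|,|delta| <= k_i *)
  (forall i a b, gc i a b != 0 -> (mdeg a <= k i)%N && (mdeg b <= k i)%N) ->
  (* sphere assumption *)
  0 < rad ->
  (exists i1 i2 : 'I_m, gc i1 = sphere_coef rad /\
                        gc i2 = (fun a b => - sphere_coef rad a b)) ->
  hermitian_seq y ->
  (has_rep_measure (Kset k gc) y <->
   forall (d : nat) (i : 'I_m.+1),
     mom_psd d (mom_entry (ext0 k 0%N i) (ext0 gc (@one_coef R n) i) y)).
Proof.
move=> n0 _ gch gdeg rad0 [i1 [i2 [gi1 gi2]]] _.
have ext0i i : ext0 k 0%N (lift ord0 i) = k i /\
    ext0 gc (@one_coef R n) (lift ord0 i) = gc i.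
  by rewrite /ext0 liftK.
have ext00 : ext0 k 0%N ord0 = 0%N /\ ext0 gc (@one_coef R n) ord0 = @one_coef R n.
  by rewrite /ext0 unlift_none.
have g0E : gpoly 0 (@one_coef R n) = 1 :> mpoly (n + n) (Cpx R) by exact: gpoly_one.
split.
  (* Necessity: L(|P|^2 g_j) is the integral of a function that is nonnegative on K. *)
  case=> mu [muK [mufin murep]] d i.
  have rep q : cintegrable mu (fun z => ev (coord z) q) /\
               riesz y q = cint mu (fun z => ev (coord z) q).
    apply: (@cint_riesz _ _ _ _ mu id y _ q) => a b.
    have [h1 [h2 h3]] := murep a b; split.
      by apply: (eq_cintegrable (f := fun z => zbarmon z a * zmon z b)) => // z;
        rewrite ev_coord_mono.
    rewrite h3; apply: eq_cint => z; by rewrite /= ev_coord_mono.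
  have mK : measurable (~` Kset k gc).
    by apply: measurableC; apply: measurable_Kset.
  suff H j : forall P, 0 <= riesz y (antP P * holP P *
      gpoly (ext0 k 0%N j) (ext0 gc (@one_coef R n) j)).
    exact: (mom_psdP _ _ _).2 (H i) d.
  move=> P; have [Ij ->] := rep (antP P * holP P *
    gpoly (ext0 k 0%N j) (ext0 gc (@one_coef R n) j)).
  apply: (cint_ge0 mK muK Ij) => z /contrapT Kz.
  apply: ev_sqM_ge0.
  case: (unliftP ord0 j) => [j' ->|->].
    by rewrite (ext0i j').1 (ext0i j').2 ev_gpoly; exact: Kz.
  by rewrite ext00.1 ext00.2 g0E -(rmorph1 (mpolyC (n + n) (R := Cpx R))) evC.
move=> psd.
pose L := riesz y : mpoly (n + n) (Cpx R) -> (Cpx R).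
have LG i P : 0 <= L (antP P * holP P * gpoly (ext0 k 0%N i) (ext0 gc (@one_coef R n) i)).
  by move: P; apply/mom_psdP => d; exact: psd.
have L1 P : 0 <= L (antP P * holP P).
  by have := LG ord0 P; rewrite ext00.1 ext00.2 g0E mulr1.
have Lg i P : 0 <= L (antP P * holP P * gpoly (k i) (gc i)).
  by have := LG (lift ord0 i) P; rewrite (ext0i i).1 (ext0i i).2.
pose r : (Cpx R) := Complex rad 0.
have r0 : 0 < r by rewrite ltcE /= eqxx.
(* The coefficient -1 at a degree-one index forces both sphere constraints to have k_i >= 1, so
   their truncated sums contain all of |z_j|^2. *)
pose j0 : 'I_n := Ordinal n0.
have sc1 : sphere_coef rad (unitmi j0) (unitmi j0) = -1 :> (Cpx R).
  rewrite /sphere_coef mdeg_unitmi !eqxx /=.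
  by case: eqP => // h; have := mdeg_unitmi j0; rewrite h mdeg_mzero.
have kpos i : gc i (unitmi j0) (unitmi j0) != 0 -> (0 < k i)%N.
  by move/gdeg; rewrite mdeg_unitmi => /andP[].
have k1 : (0 < k i1)%N by apply: kpos; rewrite gi1 sc1 oppr_eq0 oner_eq0.
have k2 : (0 < k i2)%N by apply: kpos; rewrite gi2 sc1 opprK oner_eq0.
have scE (a b : mi n) : sphere_coef rad a b =
   (if (a == mzero n) && (b == mzero n) then r ^+ 2
     else if (a == b) && (mdeg a == 1)%N then -1 else 0) :> (Cpx R).
  by rewrite /sphere_coef /r expr2; case: ifP => // _; rewrite -(rmorphXn (@real_complex R)).
have s1 : gpoly (k i1) (gc i1) = sphP n r.
  by rewrite gi1; exact: gpoly_sphere.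
have s2 : gpoly (k i2) (gc i2) = - sphP n r.
  by rewrite gi2 gpolyN; congr (- _); exact: gpoly_sphere.
(* The two opposite constraints squeeze L(|P|^2 s) to 0; polarization does the rest. *)
have Lsph q : L (q * sphP n r) = 0.
  move: q; apply: (@sesquilinear_eq0 (Cpx R) n (fun q => L (q * sphP n r))).
  - by move=> p q; rewrite mulrDl; exact: rieszD.
  - by move=> c p; rewrite -scalerAl; exact: rieszZ.
  move=> P; apply/eqP; rewrite eq_le; apply/andP; split.
    by have := Lg i2 P; rewrite s2 mulrN /L (raddfN (riesz y)) oppr_ge0.
  by have := Lg i1 P; rewrite s1.
have LD p q : L (p + q) = L p + L q by exact: rieszD.
have LZ c p : L (c *: p) = c * L p by exact: rieszZ.
have Lsos q : sos r q -> 0 <= L q by exact: sos_ge0.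
have Lgsos i q : sos r q -> 0 <= L (q * gpoly (k i) (gc i)).
  apply: (@sos_ge0 (Cpx R) n r (fun q => L (q * gpoly (k i) (gc i)))).
  - by move=> p p'; rewrite mulrDl LD.
  - exact: Lg.
  - by move=> f; rewrite mulrAC Lsph.
have [P [F [Pfin mF Fbd Prep]]] := moment_representation n0 rad0 LD LZ Lsos.
pose f i t := complex.Re (peval (k i) (gc i) (F t)).
have pevalE i t : peval (k i) (gc i) (F t) = Complex (f i t) 0.
  have := peval_real (F t) (k i) (gch i); rewrite /f.
  case: (peval _ _ _) => u v /eqP; rewrite eq_complex /= => /andP[_ /eqP h].
  by congr Complex; lra.
have fneg i : P [set t | f i t < 0] = 0%E.
  have [c c0 sc] := sos_bounded_gpoly (k i) r0 (gch i).
  have [K0 K0b] := Fbd (gpoly (k i) (gc i)).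
  have ge0C (z : Cpx R) : 0 <= z -> z = Complex (complex.Re z) 0 /\ 0 <= complex.Re z.
    by case: z => u v; rewrite lecE /= => /andP[/eqP -> ->].
  have K00 : 0 <= K0 by apply: le_trans (normr_ge0 _) (K0b point).
  have [cE cR] := ge0C c c0; have [KE KR] := ge0C _ K00.
  (* One constant for two purposes: kap >= c keeps kap - g_i in the cone, and kap >= K0 bounds g_i
     along F, which may leave the sphere where the cone says nothing pointwise. The 1 makes it
     positive. *)
  pose kap : R := complex.Re c + complex.Re K0 + 1.
  have kap0 : 0 < kap by rewrite /kap ltr_wpDl// addr_ge0.
  have skap : sos r (mpolyC (n + n) (Complex kap 0 : Cpx R) - gpoly (k i) (gc i)).
    have -> : mpolyC (n + n) (Complex kap 0 : Cpx R) - gpoly (k i) (gc i) =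
      mpolyC (n + n) ((Complex kap 0 : Cpx R) - c) + (mpolyC (n + n) c - gpoly (k i) (gc i)).
      by rewrite rmorphB /= addrA subrK.
    apply: sosD => //; apply: sosC; rewrite subr_ge0 cE lecE /= eqxx /kap /=; lra.
  have fkap t : f i t <= kap.
    have := K0b t; rewrite ev_gpoly pevalE KE => h.
    have h2 : `|f i t| <= complex.Re K0.
      by move: h; rewrite normc_def /= lecE /= eqxx expr0n /= addr0 sqrtr_sqr.
    by apply: le_trans (ler_norm _) _; apply: le_trans h2 _; rewrite /kap; lra.
  have evE N t : ev (coord (F t))
      ((mpolyC (n + n) (Complex kap 0 : Cpx R) - gpoly (k i) (gc i)) ^+ N *
       gpoly (k i) (gc i)) =
      Complex (f i t * (kap - f i t) ^+ N) 0.
    rewrite evM evX evB evC ev_gpoly pevalE mulrC.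
    have -> : (Complex kap 0 : Cpx R) - Complex (f i t) 0 = Complex (kap - f i t) 0.
      by apply/eqP; rewrite eq_complex /= subrr !eqxx.
    rewrite -(rmorphXn (@real_complex R)) /=.
    by rewrite -(rmorphM (@real_complex R)).
  apply: (support_ge0 Pfin kap0 fkap) => N.
    have [[I1 _] _] := Prep ((mpolyC (n + n) (Complex kap 0 : Cpx R) - gpoly (k i) (gc i)) ^+ N
       * gpoly (k i) (gc i)).
    by move: I1; under eq_fun do rewrite evE.
  have := Lgsos i _ (sosX N skap).
  have [_ ->] := Prep ((mpolyC (n + n) (Complex kap 0 : Cpx R) - gpoly (k i) (gc i)) ^+ N
       * gpoly (k i) (gc i)).
  rewrite (eq_cint _ (evE N)) /cint lecE => /andP[_] /=.
  by [].
have mf i : measurable_fun setT (f i).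
  rewrite /f (_ : (fun t => _) =
    (fun z => complex.Re (ev (coord z) (gpoly (k i) (gc i)))) \o F).
    by apply: measurableT_comp => //; have [] := measurable_ev (gpoly (k i) (gc i)).
  by apply/funext => t /=; rewrite ev_gpoly.
have mK := measurable_Kset k gc.
(* The representing measure is the law of F. *)
unshelve (exists (pushforward P F)); first exact: mF.
split; last split.
- rewrite /= /pushforward; apply: measure_negligible.
    by rewrite -[X in measurable X]setTI; apply: mF => //; exact: measurableC.
  (* Outside K some constraint fails, and g_i is real, so the preimage lies in a finite union of
     null sets. *)
  apply: (@negligibleS _ _ _ _ (\big[setU/set0]_(i <- index_enum 'I_m) [set t | f i t < 0])).
    rewrite -bigcup_seq => t /= nK.
    have /existsNP[i fi] : ~ forall i, 0 <= peval (k i) (gc i) (F t) by [].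
    exists i; first exact: mem_index_enum.
    rewrite /= ltNge; apply/negP => f0; apply: fi.
    by rewrite pevalE lecE /= eqxx.
  elim/big_ind: _ => [|A A'|i _]; [exact: negligible_set0|exact: negligibleU|].
  apply/negligibleP; last exact: fneg.
  rewrite (_ : [set t | _] = f i @^-1` `]-oo, 0[).
    by rewrite -[X in measurable X]setTI; exact: mf.
  by apply/seteqP; split => x /=; rewrite in_itv.
- exact: Pfin.
move=> a b; have [[I1 I2] Eab] := Prep (mono (Cpx R) a b).
have [M1 M2] := measurable_ev (mono (Cpx R) a b).
have eM (z : Cn R n) : zbarmon z a * zmon z b = ev (coord z) (mono (Cpx R) a b).
  by rewrite ev_coord_mono.
under eq_fun do rewrite eM.
split; [|split].
- by apply: integrable_pushforward => //; exact/measurable_EFinP.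
- under eq_fun do rewrite eM.
  by apply: integrable_pushforward => //; exact/measurable_EFinP.
have e1 : (\int[pushforward P F]_z (complex.Re (ev (coord z) (mono (Cpx R) a b)))%:E =
    \int[P]_t (complex.Re (ev (coord (F t)) (mono (Cpx R) a b)))%:E)%E.
  by rewrite integral_pushforward//; exact/measurable_EFinP.
have e2 : (\int[pushforward P F]_z (complex.Im (ev (coord z) (mono (Cpx R) a b)))%:E =
    \int[P]_t (complex.Im (ev (coord (F t)) (mono (Cpx R) a b)))%:E)%E.
  by rewrite integral_pushforward//; exact/measurable_EFinP.
rewrite /Rintegral.
under eq_integral do rewrite eM.
under [X in Complex _ (fine X)]eq_integral do rewrite eM.
by rewrite e1 e2 -riesz_mono; exact: Eab.
Qed.
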